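(* Let $G$ be a non-trivial finite group, let $n$ be an integer, let $P$ be a $G$-poset such that $\|\Delta(P)\|$ is $n$-connected, and let $Q$ be a free $G$-poset with $\chi\left(\widetilde{C}_Q\right)\leq n+1$. Then: (a) there is no continuous $G$-equivariant map from $\|\Delta(P)\|$ to $\|\Delta(Q)\|$; (b) if $\lambda:P\to Q$ is a map with $\lambda(g\cdot x)=g\cdot\lambda(x)$ for all $g\in G$, $x\in P$, then there exist comparable elements $x,y$ of $P$ such that $\lambda(x)$ and $\lambda(y)$ are not comparable in $Q$.
   Context: A $G$-poset is a partially ordered set with an action of $G$ preserving the order ($x\preceq y\Rightarrow g\cdot x\preceq g\cdot y$); it is free if $g\cdot x=x$ implies $g=e$ (the identity). For $x$ in a $G$-poset, $[x]=\{g\cdot x:g\in G\}$. The strong compatibility graph $\widetilde{C}_Q$ of a $G$-poset $Q$ has vertex set $Q$, with $x,y$ adjacent if there is $g\in G\setminus\{e\}$ such that $x$ and $g\cdot y$ are comparable in $Q$ and $y\notin[x]$. $\Delta(P)$ is the order complex of $P$ (simplices are chains of $P$) with the induced $G$-action; $\|\cdot\|$ is geometric realization. A space is $k$-connected if its homotopy groups $\pi_0,\dots,\pi_k$ are trivial ($(-1)$-connected means nonempty). $\chi$ is the chromatic number. *)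

(* Defs.v *)
From HB Require Import structures.
From mathcomp Require Import all_boot all_order all_algebra all_fingroup.
From mathcomp Require Import all_classical all_reals all_analysis.
From mathcomp Require Import Rstruct Rstruct_topology.
Set Implicit Arguments. Unset Strict Implicit. Unset Printing Implicit Defensive.
Import Order.TTheory GRing.Theory Num.Theory.
Local Open Scope classical_set_scope.
Local Open Scope ring_scope.

Notation RR := Rdefinitions.R.

Section Gposet.
Variables (gT : finGroupType) (d : Order.disp_t) (P : porderType d).

Definition is_Gposet (act : gT -> P -> P) : Prop :=
  [/\ forall x, act 1%g x = x,
      forall g h x, act (g * h)%g x = act g (act h x)
    & forall g x y, (x <= y)%O -> (act g x <= act g y)%O].

Definition is_free (act : gT -> P -> P) : Prop :=
  forall g x, act g x = x -> g = 1%g.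

Definition orbit_of (act : gT -> P -> P) (x : P) : set P :=
  [set act g x | g in [set: gT]].

Definition comparable_in (x y : P) : Prop := (x <= y)%O \/ (y <= x)%O.

Definition strong_compat_adj (act : gT -> P -> P) (x y : P) : Prop :=
  (exists g : gT, g != 1%g /\ comparable_in x (act g y)) /\ ~ orbit_of act x y.
End Gposet.

Definition chromatic_le (V : Type) (adj : V -> V -> Prop) (m : int) : Prop :=
  exists k : nat, (k%:Z <= m)%R /\
    exists c : V -> 'I_k, forall x y, adj x y -> c x <> c y.

Section Realization.
Variables (d : Order.disp_t) (P : porderType d).

Definition supp (a : P -> RR) : set P := [set x | a x != 0].

Definition chain_set (S : set P) : Prop :=
  forall x y, S x -> S y -> comparable_in x y.

(* points of ||Delta(P)||: finitely supported convex combinations of the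
   vertices of P whose support is a chain *)
Definition simplex_pt (a : P -> RR) : Prop :=
  [/\ forall x, 0 <= a x, finite_set (supp a), chain_set (supp a)
    & \sum_(x \in supp a) a x = 1].

Record realization := Real { rpt : P -> RR; rptP : simplex_pt rpt }.

HB.instance Definition _ := gen_eqMixin realization.
HB.instance Definition _ := gen_choiceMixin realization.

(* weak (coherent) topology: U is open iff its trace on every closed simplex
   Delta_c (c a finite chain) is open in the Euclidean topology of Delta_c
   (= subspace topology of the product topology on P -> R) *)
Definition real_open (U : set realization) : Prop :=
  forall c : set P, finite_set c -> chain_set c ->
    exists V : set {ptws P -> RR}, open V /\
      forall b : realization, supp (rpt b) `<=` c -> (V (rpt b) <-> U b).

Lemma real_openT : real_open setT.
Proof. by move=> c _ _; exists setT; split => [|b _]; [exact: openT|]. Qed.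

Lemma real_openI : setI_closed real_open.
Proof.
move=> A B oA oB c fc cc.
have [V [oV HV]] := oA c fc cc; have [W [oW HW]] := oB c fc cc.
exists (V `&` W); split; first exact: openI.
move=> b bc; split.
  by move=> [/(HV b bc) ? /(HW b bc) ?].
by move=> [/(HV b bc) ? /(HW b bc) ?].
Qed.

Lemma real_open_bigU (I : Type) (f : I -> set realization) :
  (forall i, real_open (f i)) -> real_open (\bigcup_i f i).
Proof.
move=> ofi c fc cc.
have [V HV] := choice (fun i => ofi i c fc cc).
exists (\bigcup_i V i); split.
  by apply: bigcup_open => i _; case: (HV i).
move=> b bc; split.
  by move=> [i _ /((HV i).2 b bc) ?]; exists i.
by move=> [i _ /((HV i).2 b bc) ?]; exists i.
Qed.

HB.instance Definition _ :=
  isOpenTopological.Build realization real_openT real_openI real_open_bigU.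

End Realization.
Arguments realization {d} P.

(* induced action on ||Delta(P)||:  b = g . a  iff  b(y) = a(g^-1 . y) *)
Definition is_translate (gT : finGroupType) d (P : porderType d)
  (act : gT -> P -> P) (g : gT) (a b : realization P) : Prop :=
  forall y, rpt b y = rpt a (act g^-1%g y).

Definition real_equivariant (gT : finGroupType) d (P : porderType d)
  d' (Q : porderType d') (actP : gT -> P -> P) (actQ : gT -> Q -> Q)
  (F : realization P -> realization Q) : Prop :=
  forall g a b, is_translate actP g a b -> is_translate actQ g (F a) (F b).

Definition usphere (k : nat) : set 'rV[RR]_k.+1 :=
  [set v | \sum_(i < k.+1) v ord0 i ^+ 2 = 1].

Definition usphere_base (k : nat) : 'rV[RR]_k.+1 :=
  \row_(i < k.+1) (i == ord0)%:R.
Arguments usphere k : clear implicits.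
Arguments usphere_base k : clear implicits.

Definition pi_trivial (X : topologicalType) (k : nat) (x : X) : Prop :=
  forall f : 'rV[RR]_k.+1 -> X,
    {within (usphere k), continuous f} -> f (usphere_base k) = x ->
    exists H : RR * 'rV[RR]_k.+1 -> X,
      [/\ {within [set t : RR | 0 <= t <= 1] `*` (usphere k), continuous H},
          (forall v, usphere k v -> H (0, v) = f v /\ H (1, v) = x)
        & (forall t : RR, 0 <= t <= 1 -> H (t, usphere_base k) = x)].

Definition n_connected (X : topologicalType) (n : int) : Prop :=
  ((-1 <= n)%R -> exists x : X, True) /\
  forall k : nat, (k%:Z <= n)%R -> forall x : X, pi_trivial k x.

(* Main.v *)
Require Import Defs.
From HB Require Import structures.
From mathcomp Require Import all_boot all_order all_algebra all_fingroup.
From mathcomp Require Import all_classical all_reals all_analysis.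
From mathcomp Require Import Rstruct Rstruct_topology.
From mathcomp Require Import cyclic pgroup.
From mathcomp Require Import ring lra zify.
Set Implicit Arguments. Unset Strict Implicit. Unset Printing Implicit Defensive.
Import Order.TTheory GRing.Theory Num.Theory.
Import numFieldNormedType.Exports.
Local Open Scope ring_scope.

(* By Cauchy's theorem it suffices to use an element [s] of prime order [p].
   A colouring of the strong compatibility graph with [k <= n + 1] colours,
   together with the position of a point in its [s]-orbit, labels [Q] by pairs
   (colour, element of Z/p) so that comparable points of the same colour have
   equal Z/p-components. A map as in (a), or a comparability preserving map as
   in (b), pulls the barycentric masses of these labels back to continuous
   weights on the realization [X] of [P], permuted by [s].

   Since [X] is [(k - 1)]-connected, there is an equivariant map to [X] from the
   join [E] of [k + 1] copies of Z/p. Labelling the points of [E] by a heavy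
   weight contradicts a Z/p-Tucker lemma. The latter is proved with cochains:
   from the periodic resolution of Z/p one gets alternating cochains [cocycle d]
   on the labels, with values in Z/p, and chains [c_d] of [E]; the value of
   [cocycle d] on a fine subdivision of [c_d] does not depend on [d], is [1] for
   [d = 0], and is [0] for [d = k] because there are only [k] colours. *)

(** * Cochains on the Kuhn triangulation of a grid *)

(** The number of colours enters as a dimension count: a simplex of [c_k] is cut into cells with
    [k + 1] vertices, the labels of a cell form a compatible list over [k] colours, and such a list
    repeats a label, so an alternating cochain vanishes on it.

    Compatibility is what makes equivariant choices possible. As a set of labels, a whole colour
    class is fixed by the shift, so no element of Z/p can be attached to it equivariantly. A
    nonempty compatible set carries one, the component of its least colour, and this gives explicit
    primitives in the periodic resolution. For this reason comparable points of equal colour must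
    have equal components. The coefficients are in Z/p because the recursion for the cochains starts
    from the constant 1 on vertices, whose norm is p.

    Labels are attached to the points of [E], not to the vertices of a triangulation. Subdivided
    simplices then agree on common faces automatically, and every simplex can be cut by a cubical
    grid, whose collapsed faces are invisible to alternating cochains. *)

Section Boundary.
Variables (F : comNzRingType).

(** The augmented simplicial coboundary: the one-entry list has the empty list as its face.
    Splitting off the first deletion turns most identities into inductions with [u] generalized;
    [cobdE] recovers the usual alternating sum. *)
Fixpoint cobd (A : Type) (u : seq A -> F) (t : seq A) : F :=
  if t is x :: t' then u t' - cobd (fun s => u (x :: s)) t' else 0.

Definition delete_at (A : Type) (i : nat) (t : seq A) : seq A := take i t ++ drop i.+1 t.

Lemma eq_cobd_subseq (A : eqType) (u u' : seq A -> F) t :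
  (forall s, subseq s t -> u s = u' s) -> cobd u t = cobd u' t.
Proof.
elim: t u u' => [//|x t IH] u u' e /=; congr (_ - _).
  by apply: e; exact: subseq_cons.
by apply: IH => s st; apply: e; rewrite /= eqxx.
Qed.

Lemma cobdB (A : Type) (u u' : seq A -> F) t :
  cobd (fun s => u s - u' s) t = cobd u t - cobd u' t.
Proof.
elim: t u u' => [|x t IH] u u' /=; first by rewrite subr0.
by rewrite IH; ring.
Qed.

Lemma cobd0 (A : Type) t : cobd (fun _ : seq A => 0) t = 0.
Proof. by elim: t => [//|x t IH] /=; rewrite IH subr0. Qed.

Lemma cobdN (A : Type) (u : seq A -> F) t : cobd (fun s => - u s) t = - cobd u t.
Proof.
rewrite -[RHS]add0r -(cobd0 t) -cobdB; congr cobd.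
by apply: funext => s; rewrite sub0r.
Qed.

Lemma cobd_sum (A : Type) (I : Type) (r : seq I) (u : I -> seq A -> F) t :
  cobd (fun s => \sum_(i <- r) u i s) t = \sum_(i <- r) cobd (u i) t.
Proof.
elim: r => [|i r IH].
  by rewrite big_nil -[RHS](cobd0 t); congr cobd; apply: funext => s; rewrite big_nil.
rewrite big_cons -IH -[X in _ + X]opprK -cobdN -cobdB; congr cobd.
by apply: funext => s; rewrite big_cons opprK.
Qed.

Lemma cobd_map (A B : Type) (g : A -> B) (u : seq B -> F) t :
  cobd u (map g t) = cobd (fun s => u (map g s)) t.
Proof. by elim: t u => [//|x t IH] u /=; rewrite IH. Qed.

Lemma cobd_cobd (A : Type) (u : seq A -> F) t : cobd (cobd u) t = 0.
Proof.
elim: t u => [//|x t IH] u /=.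
by rewrite cobdB IH; ring.
Qed.

Lemma cobdE (A : Type) (u : seq A -> F) t :
  cobd u t = \sum_(i < size t) (-1) ^+ i * u (delete_at i t).
Proof.
elim: t u => [|x t IH] u /=; first by rewrite big_ord0.
rewrite big_ord_recl expr0 mul1r /delete_at /= drop0 IH; congr (_ + _).
rewrite -sumrN; apply: eq_bigr => i _.
by rewrite /bump add1n exprS; ring.
Qed.

(** The second clause does not follow from the first in characteristic 2, which is the case
    [p = 2]. *)
Definition alternating (A : Type) (u : seq A -> F) :=
  (forall a x y b, u (a ++ x :: y :: b) = - u (a ++ y :: x :: b)) /\
  (forall a x b, u (a ++ x :: x :: b) = 0).

Lemma alternating_cons (A : Type) (u : seq A -> F) c :
  alternating u -> alternating (fun s => u (c :: s)).
Proof.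
by case=> ua uv; split => [a x y b|a x b]; [exact: (ua (c :: a))|exact: (uv (c :: a))].
Qed.

Lemma alternating_cobd (A : Type) (u : seq A -> F) :
  alternating u -> alternating (cobd u).
Proof.
move=> altu; split => [a x y b|a x b].
  elim: a u altu => [|c a IH] u altu /=.
    have e : (fun s => u [:: x, y & s]) = fun s => - u [:: y, x & s].
      by apply: funext => s; exact: (altu.1 [::]).
    by rewrite e cobdN; ring.
  by rewrite altu.1 IH; [ring|exact: alternating_cons].
elim: a u altu => [|c a IH] u altu /=.
  have e : (fun s => u [:: x, x & s]) = fun s => 0.
    by apply: funext => s; exact: (altu.2 [::]).
  by rewrite e cobd0; ring.
by rewrite altu.2 IH; [ring|exact: alternating_cons].
Qed.

Lemma alternating_dup (A : eqType) (u : seq A -> F) t :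
  alternating u -> ~~ uniq t -> u t = 0.
Proof.
move=> altu; elim: t u altu => [//|x t IH] u altu /=.
rewrite negb_and negbK => /orP[|nt]; last first.
  by apply: (IH (fun s => u (x :: s))) => //; exact: alternating_cons.
case/path.splitPr => b c {t IH}.
elim: b u altu => [|y b IH] u altu; first exact: (altu.2 [::]).
rewrite (altu.1 [::]) /= (IH (fun s => u (y :: s))) ?oppr0 //.
exact: alternating_cons.
Qed.

End Boundary.

Section Prism.
Variables (F : comNzRingType).

(* The transpose of the prism operator from the bottom [b] to the top [t]. *)
Fixpoint prism (A B : Type) (b t : A -> B) (phi : seq B -> F) (ys : seq A) : F :=
  if ys is y :: ys' then
    phi (b y :: t y :: map t ys') - prism b t (fun s => phi (b y :: s)) ys'
  else 0.

Lemma prismB (A B : Type) (b t : A -> B) (u u' : seq B -> F) ys :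
  prism b t (fun s => u s - u' s) ys = prism b t u ys - prism b t u' ys.
Proof.
elim: ys u u' => [|x ys IH] u u' /=; first by rewrite subr0.
by rewrite IH; ring.
Qed.

(** The chain homotopy formula of the prism between its two ends, transposed to cochains. *)
Lemma prism_cobd (A B : Type) (b t : A -> B) (phi : seq B -> F) ys :
  prism b t (cobd phi) ys =
  phi (map t ys) - phi (map b ys) - cobd (prism b t phi) ys.
Proof.
elim: ys phi => [|y ys IH] phi /=; first by ring.
by rewrite prismB IH cobdB cobd_map; ring.
Qed.

Lemma prism_map (A A' B B' : Type) (b t : A -> B) (b' t' : A' -> B')
  (g : A -> A') (g' : B -> B') (phi : seq B' -> F) ys :
  (forall y, b' (g y) = g' (b y)) -> (forall y, t' (g y) = g' (t y)) ->
  prism b' t' phi (map g ys) = prism b t (fun s => phi (map g' s)) ys.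
Proof.
move=> hb ht; elim: ys phi => [//|y ys IH] phi /=.
rewrite IH hb ht -!map_comp; congr (phi [:: _, _ & _] - _).
- by apply: eq_map => z /=; exact: ht.
Qed.

Variable N : nat.

(* [grid_chain k phi] is the value of the cochain [phi] on the fundamental chain of the
   Kuhn triangulation of the cube [0, N]^k. *)
Fixpoint grid_chain (k : nat) (phi : seq (seq nat) -> F) : F :=
  if k is k'.+1 then
    \sum_(j < N) grid_chain k' (prism (cons (j : nat)) (cons j.+1) phi)
  else phi [:: [::]].

Lemma grid_chainS k phi :
  grid_chain k.+1 phi = \sum_(j < N) grid_chain k (prism (cons (j : nat)) (cons j.+1) phi).
Proof. by []. Qed.

Lemma grid_chain0 k : grid_chain k (fun _ => 0) = 0.
Proof.
have pr0 (b t : seq nat -> seq nat) ys : prism b t (fun _ => 0) ys = 0 :> F.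
  by elim: ys => [//|y ys IH] /=; rewrite IH subr0.
elim: k => [//|k IH] /=; rewrite big1 // => j _.
by rewrite -[RHS]IH; congr grid_chain; apply: funext => ys; exact: pr0.
Qed.

Lemma grid_chainB k phi psi : grid_chain k (fun s => phi s - psi s) =
  grid_chain k phi - grid_chain k psi.
Proof.
elim: k phi psi => [//|k IH] phi psi /=.
rewrite -sumrB; apply: eq_bigr => j _; rewrite -IH; congr grid_chain.
by apply: funext => ys; exact: prismB.
Qed.

Lemma grid_chainN k phi : grid_chain k (fun s => - phi s) = - grid_chain k phi.
Proof.
rewrite -[RHS]add0r -(grid_chain0 k) -grid_chainB; congr grid_chain.
by apply: funext => s; rewrite sub0r.
Qed.

Lemma grid_chain_sum k (I : Type) (r : seq I) (u : I -> _) :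
  grid_chain k (fun s => \sum_(i <- r) u i s) = \sum_(i <- r) grid_chain k (u i).
Proof.
elim: r => [|i r IH].
  by rewrite big_nil -[RHS](grid_chain0 k); congr grid_chain; apply: funext => s;
    rewrite big_nil.
rewrite big_cons -IH -[X in _ + X]opprK -grid_chainN -grid_chainB; congr grid_chain.
by apply: funext => s; rewrite big_cons opprK.
Qed.

Fixpoint insert_at (i : nat) (c : nat) (y : seq nat) : seq nat :=
  if i is i'.+1 then (if y is a :: y' then a :: insert_at i' c y' else [:: c]) else c :: y.

(** Stokes on the cube. The homotopy formula on each slab leaves the two end slices, which telescope
    in the first coordinate, and the boundary of the cross-section, where induction applies because
    the prism commutes with inserting a later coordinate. *)
Lemma grid_chain_cobd k phi : grid_chain k.+1 (cobd phi) =
  \sum_(i < k.+1) (-1) ^+ i *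
     (grid_chain k (fun s => phi (map (insert_at i N) s))
       - grid_chain k (fun s => phi (map (insert_at i 0) s))).
Proof.
elim: k phi => [|k IH] phi.
  rewrite big_ord1 expr0 mul1r /=.
  under eq_bigr => j _ do rewrite !subr0.
  rewrite -(big_mkord xpredT (fun j => phi [:: [:: j.+1]] - phi [:: [:: j]])).
  by rewrite telescope_sumr.
have -> : grid_chain k.+2 (cobd phi) =
    \sum_(j < N) ((grid_chain k.+1 (fun s => phi (map (cons j.+1) s)) -
                  grid_chain k.+1 (fun s => phi (map (cons (j : nat)) s))) -
      grid_chain k.+1 (cobd (prism (cons (j : nat)) (cons j.+1) phi))).
  rewrite grid_chainS; apply: eq_bigr => j _; rewrite -!grid_chainB; congr grid_chain.
  by apply: funext => ys; exact: prism_cobd.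
rewrite sumrB -(big_mkord xpredT (fun j => grid_chain k.+1 (fun s => phi (map (cons j.+1)
  s)) -
                  grid_chain k.+1 (fun s => phi (map (cons j) s)))) telescope_sumr //.
rewrite [RHS]big_ord_recl expr0 mul1r; congr (_ + _).
under eq_bigr => j _ do rewrite IH.
rewrite exchange_big /= -sumrN; apply: eq_bigr => i _.
rewrite -mulr_sumr sumrB /bump add1n exprS mulN1r mulNr; congr (- (_ * (_ - _)));
  apply: eq_bigr => j _; congr grid_chain; apply: funext => ys;
  by apply: prism_map => y.
Qed.

Definition close (y y' : seq nat) :=
  size y = size y' /\ forall i, (nth 0%N y i <= (nth 0%N y' i).+1)%N.

(** Only what later arguments require of a Kuhn simplex is recorded: the number of its vertices,
    their range, and that no coordinate varies by more than one. *)
Definition grid_simplex (k : nat) (ys : seq (seq nat)) :=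
  [/\ size ys = k.+1, forall y, y \in ys -> size y = k /\ all (fun a => a <= N)%N y
    & forall y y', y \in ys -> y' \in ys -> close y y'].

End Prism.

Section GridSupport.
Variables (F : comNzRingType) (N : nat).

Lemma prism_eq0 (A B : Type) (b t : A -> B) (phi : seq B -> F) ys :
  (forall y1 y y2, ys = y1 ++ y :: y2 ->
     phi (map b y1 ++ b y :: t y :: map t y2) = 0) ->
  prism b t phi ys = 0.
Proof.
elim: ys phi => [//|y ys IH] phi h /=.
rewrite (h [::] y ys) // IH ?subr0 // => y1 z y2 e.
by rewrite (h (y :: y1) z y2) // e.
Qed.

Lemma grid_chain_eq0 k (phi : seq (seq nat) -> F) :
  (forall ys, grid_simplex N k ys -> phi ys = 0) -> grid_chain N k phi = 0.
Proof.
elim: k phi => [|k IH] phi h.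
  apply: h; split => //.
  - by move=> y; rewrite inE => /eqP ->.
  - by move=> y y'; rewrite !inE => /eqP -> /eqP ->; split.
rewrite grid_chainS big1 // => j _; apply: IH => ys [sys eys cys].
apply: prism_eq0 => y1 y y2 e; apply: h.
set l := _ ++ _.
have lP z : z \in l -> exists a y', [/\ z = a :: y', y' \in ys, (j <= a)%N & (a <= j.+1)%N].
  rewrite mem_cat => /orP[/mapP[y' y'1 ->]|].
    by exists (j : nat), y'; rewrite e mem_cat y'1 leqnn leqnSn.
  rewrite !inE => /or3P[/eqP ->|/eqP ->|/mapP[y' y'1 ->]].
  - by exists (j : nat), y; rewrite e mem_cat inE eqxx orbT leqnn leqnSn.
  - by exists j.+1, y; rewrite e mem_cat inE eqxx orbT leqnn leqnSn.
  - by exists j.+1, y'; rewrite e mem_cat inE y'1 !orbT leqnn leqnSn.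
split.
- move: sys; rewrite e /l !size_cat /= !size_map; lia.
- move=> z /lP[a [y' [-> /eys[<- ay'] _ aj]]]; split => //=.
  by rewrite ay' andbT (leq_trans aj).
- move=> z z' /lP[a [y' [-> y'ys ja aj]]] /lP[a' [y'' [-> y''ys ja' aj']]].
  have [s c] := cys _ _ y'ys y''ys.
  by split => [|[|i]] /=; [rewrite s|lia|exact: c].
Qed.

Lemma eq_grid_chain k (phi psi : seq (seq nat) -> F) :
  (forall ys, grid_simplex N k ys -> phi ys = psi ys) -> grid_chain N k phi =
    grid_chain N k psi.
Proof.
move=> h; apply/eqP; rewrite -subr_eq0 -grid_chainB; apply/eqP/grid_chain_eq0 => ys /h ->.
by rewrite subrr.
Qed.

(** Wherever a prism simplex jumps from bottom to top, two neighbours [y], [y'] of the base simplex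
    still yield an adjacent pair lying entirely in the bottom or entirely in the top. *)
Lemma prism_adjacent (A B : Type) (R : A -> A -> Prop) (S : B -> B -> Prop)
    (b t : A -> B) (phi : seq B -> F) :
  (forall y y', R y y' -> S (b y) (b y') /\ S (t y) (t y')) ->
  (forall l y y' r, S y y' -> phi (l ++ y :: y' :: r) = 0) ->
  forall l y y' r, R y y' -> prism b t phi (l ++ y :: y' :: r) = 0.
Proof.
move=> hR hphi l y y' r Ryy'; have [Sb St] := hR _ _ Ryy'.
elim: l phi hphi => [|c l IH] phi hphi /=.
  rewrite (hphi [:: b y]) // (hphi [::]) //.
  rewrite prism_eq0 ?subrr // => y1 z y2 _; exact: (hphi [::]).
rewrite map_cat /= (hphi [:: _, _ & map t l]) // IH ?subrr // => l' z z' r' Szz'.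
exact: (hphi (b c :: l')).
Qed.

(** A projection of the [k]-cube to fewer coordinates degenerates every top cell. Removing leading
    coordinates one at a time reduces to [i = 0], where any two consecutive vertices agree. *)
Lemma grid_chain_degenerate k i (phi : seq (seq nat) -> F) : (i < k)%N ->
  (forall l y y' r, take i y = take i y' -> phi (l ++ y :: y' :: r) = 0) ->
  grid_chain N k phi = 0.
Proof.
elim: i k phi => [|i IH] [//|k] phi ik h.
  apply: grid_chain_eq0 => -[|y [|y' ys]] [//= sys _ _].
  by apply: (h [::]); rewrite !take0.
rewrite grid_chainS big1 // => j _; apply: (IH k) => // l y y' r e.
apply: (prism_adjacent (R := fun y y' => take i y = take i y')
  (S := fun y y' => take i.+1 y = take i.+1 y')) => //.
by move=> z z' /= ->.
Qed.

End GridSupport.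

(** * Equivariant alternating cochains on labels *)

Section Labels.
Variable p : nat.
Hypothesis p_prime : prime p.

Definition shiftv (m : nat) (a : 'F_p) (x : 'I_m * 'F_p) := (x.1, x.2 + a).

Lemma shiftv0 m : shiftv (m := m) 0 =1 id.
Proof. by case=> i j; rewrite /shiftv /= addr0. Qed.

Lemma shiftvD m a b (x : 'I_m * 'F_p) : shiftv a (shiftv b x) = shiftv (a + b) x.
Proof. by rewrite /shiftv /= -addrA (addrC b). Qed.

Lemma shiftv_inj m a : injective (@shiftv m a).
Proof. by move=> [i j] [i2 j2] /pair_equal_spec[/= -> /addIr ->]. Qed.

Definition compatible m (S : pred ('I_m * 'F_p)) : Prop :=
  forall x y, S x -> S y -> x.1 = y.1 -> x = y.

(* Equivariant on nonempty compatible sets: this trivializes the free action on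
   them. *)
Definition lead m (S : {set 'I_m * 'F_p}) : 'F_p :=
  if [pick x in S | [forall y in S, (x.1 <= y.1)%N]] is Some x then x.2 else 0.

Lemma leadP m (S : {set 'I_m * 'F_p}) : S != finset.set0 ->
  exists2 x, x \in S & lead S = x.2 /\ forall y, y \in S -> (x.1 <= y.1)%N.
Proof.
move=> /finset.set0Pn[x0 x0S]; rewrite /lead; case: pickP => [x /andP[xS /forallP h]|h].
  by exists x => //; split => // y yS; exact: (implyP (h y)).
case: (arg_minnP (P := fun x => x \in S) (fun x => nat_of_ord x.1) x0S) => x xS mx.
move: (h x); rewrite xS /= => /negP []; apply/forallP => y; apply/implyP; exact: mx.
Qed.

Lemma lead_set0 m : lead (@finset.set0 ('I_m * 'F_p)%type) = 0.
Proof. by rewrite /lead; case: pickP => // x; rewrite inE. Qed.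

Lemma lead_shift m a (S S' : {set 'I_m * 'F_p}) : compatible (mem S) ->
  S != finset.set0 ->
  (forall x, (shiftv a x \in S') = (x \in S)) -> lead S' = lead S + a.
Proof.
move=> cS S0 SS'.
have {}SS' x : (x \in S') = (shiftv (- a) x \in S).
  by rewrite -SS' shiftvD subrr shiftv0.
have /leadP[y yS' [-> my]] : S' != finset.set0.
  case/finset.set0Pn: S0 => x xS; apply/finset.set0Pn; exists (shiftv a x).
  by rewrite SS' shiftvD addNr shiftv0.
have [x xS [-> mx]] := leadP S0.
move: yS'; rewrite SS' => yS.
suff -> : x = shiftv (- a) y by rewrite /= subrK.
apply: cS => //=; apply/val_inj/eqP; rewrite eqn_leq (mx _ yS) /=.
by have := my (shiftv a x); apply; rewrite SS' shiftvD addNr shiftv0.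
Qed.

Lemma sum_Fp (F : comNzRingType) (G : 'F_p -> F) : \sum_(i < p) G i%:R = \sum_a G a.
Proof.
rewrite -(big_mkord xpredT (fun i => G i%:R)) -[X in \sum_(0 <= _ < X) _](Fp_cast p_prime).
by rewrite big_mkord; apply: eq_bigr => a _; rewrite natr_Zp.
Qed.

Lemma ltn_Fp (a : 'F_p) : (a < p)%N.
Proof. by rewrite -[X in (_ < X)%N](Fp_cast p_prime). Qed.

Lemma val_FpS (a : 'F_p) :
  ((a + 1 : 'F_p) = (if a.+1 == p then 0%N else a.+1) :> nat).
Proof.
have -> : a + 1 = (a.+1)%:R by rewrite -natr1 natr_Zp.
rewrite val_Fp_nat //; case: eqP => [->|/eqP ne]; first by rewrite modnn.
by rewrite modn_small // ltn_neqAle ne ltn_Fp.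
Qed.

(* The differentials of the periodic resolution of Z/p: the generator minus
   one in even degree, the norm in odd degree. *)
Definition period m (d : nat) (u : seq ('I_m * 'F_p) -> 'F_p) t : 'F_p :=
  if odd d then \sum_a u (map (shiftv a) t) else u (map (shiftv 1) t) - u t.

Lemma map_shift0 m (t : seq ('I_m * 'F_p)) : map (shiftv 0) t = t.
Proof. by rewrite -[RHS]map_id; apply: eq_map; exact: shiftv0. Qed.

Lemma map_shiftD m a b (t : seq ('I_m * 'F_p)) :
  map (shiftv a) (map (shiftv b) t) = map (shiftv (a + b)) t.
Proof. by rewrite -map_comp; apply: eq_map => x; exact: shiftvD. Qed.

Lemma period_cobd m d (u : seq ('I_m * 'F_p) -> 'F_p) t : period d (cobd u) t =
  cobd (period d u) t.
Proof.
rewrite /period; case: (odd d).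
  by rewrite cobd_sum; apply: eq_bigr => a _; rewrite cobd_map.
by rewrite cobdB cobd_map.
Qed.

Lemma norm_shift m (u : seq ('I_m * 'F_p) -> 'F_p) t b :
  \sum_a u (map (shiftv a) (map (shiftv b) t)) = \sum_a u (map (shiftv a) t).
Proof.
rewrite [RHS](reindex_inj (addIr b)); apply: eq_bigr => a _.
by rewrite map_shiftD.
Qed.

Lemma period_period m d (u : seq ('I_m * 'F_p) -> 'F_p) t : period d (period d.+1 u) t = 0.
Proof.
rewrite /period /=; case: (odd d) => /=; last by rewrite norm_shift subrr.
rewrite sumrB -[X in _ - X](norm_shift _ _ 1); apply/eqP; rewrite subr_eq0; apply/eqP.
by apply: eq_bigr => a _; rewrite !map_shiftD addrC.
Qed.

(** A primitive of [h] for [period d], with [lead] giving the position in a free orbit. For the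
    norm, [h] is kept at the one translate with lead 0 and set to zero elsewhere; for generator
    minus one, the values of [h] are summed along the orbit from lead 0 up to, but excluding,
    [t]. *)
Definition period_lift m d (h : seq ('I_m * 'F_p) -> 'F_p) (t : seq ('I_m * 'F_p)) : 'F_p :=
  let c := lead [set x in t] in
  if odd d then (if c == 0 then h t else 0)
  else \sum_(i < c) h (map (shiftv (i%:R - c)) t).

(** Exactness of the periodic resolution on compatible lists: a cochain killed by the next
    differential is hit by the present one. *)
Lemma period_period_lift m d (h : seq ('I_m * 'F_p) -> 'F_p) : h [::] = 0 ->
  (forall t, compatible (mem t) -> period d.+1 h t = 0) ->
  forall t, compatible (mem t) -> period d (period_lift d h) t = h t.
Proof.
move=> h0 hD t ct.
(* The empty list is fixed by the shift, so its default lead is not equivariant; here [h0] takes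
   over. *)
have [->|t0] := eqVneq t [::].
  have l0 : period_lift d h [::] = 0.
    rewrite /period_lift h0 [X in lead X](_ : _ = finset.set0) ?lead_set0.
      by case: odd; [case: eqP|rewrite big_ord0].
    by apply/setP => x; rewrite !inE.
  by rewrite /period /= l0 subrr big1 ?if_same ?h0.
have cshift a : compatible (mem (map (shiftv a) t)).
  move=> _ _ /mapP[x xt ->] /mapP[y yt ->] /= e; congr shiftv; exact: ct.
have leadS a : lead [set x in map (shiftv a) t] = lead [set x in t] + a.
  apply: lead_shift; first by move=> x y; rewrite /= !inE; exact: ct.
    apply/finset.set0Pn; case: t t0 {ct cshift} => // x t _; exists x.
    by rewrite !inE eqxx.
  by move=> x; rewrite !inE mem_map //; exact: shiftv_inj.
set c := lead [set x in t] in leadS.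
rewrite /period /period_lift; move: hD; rewrite /period /=; case: (odd d) => /= hD.
  rewrite (bigD1 (- c)) //= leadS subrr eqxx big1 ?addr0; last first.
    by move=> a ac; rewrite leadS addrC -[c]opprK subr_eq0 (negbTE ac).
  have inv a : h (map (shiftv a) t) = h t.
    rewrite -[a]natr_Zp; elim: (nat_of_ord a) => [|i IH]; first by rewrite map_shift0.
    apply/eqP; rewrite -IH -natr1 addrC -map_shiftD -subr_eq0; apply/eqP; exact: hD.
  exact: inv.
rewrite leadS -/c val_FpS.
have e i : h (map (shiftv (i%:R - (c + 1))) (map (shiftv 1) t)) =
           h (map (shiftv (i%:R - c)) t).
  by rewrite map_shiftD; congr (h (map (shiftv _) _)); ring.
under eq_bigr do rewrite e.
rewrite -!(big_mkord xpredT (fun i => h (map (shiftv (i%:R - c)) t))).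
(* Away from the wrap-around the two partial sums differ by the term [h t]. If [c] is [p - 1], the
   shifted list has lead 0 and an empty sum, and the vanishing norm of [h] supplies the missing
   term. *)
case: eqP => [cp|_]; last first.
  by rewrite big_nat_recr //= natr_Zp subrr map_shift0 addrAC subrr add0r.
rewrite big_geq // sub0r; apply: addr0_eq.
have -> : \sum_(0 <= i < c) h (map (shiftv (i%:R - c)) t) + h t =
   \sum_(0 <= i < p) h (map (shiftv (i%:R - c)) t).
  by rewrite -[X in _ = \sum_(0 <= _ < X) _]cp big_nat_recr //= natr_Zp subrr map_shift0.
rewrite big_mkord (sum_Fp (fun a => h (map (shiftv (a - c)) t))).
under eq_bigr do rewrite -map_shiftD.
exact: hD.
Qed.

(** Each step is a connecting homomorphism: lift through the resolution, then take the coboundary.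
    The cochains live on all lists, but the lifting identities hold on compatible ones only. *)
Fixpoint cocycle m (d : nat) : seq ('I_m * 'F_p) -> 'F_p :=
  if d is d'.+1 then cobd (period_lift d' (cocycle (m :=
    m) d')) else fun t => (size t == 1%N)%:R.

Lemma cocycle_nil m d : @cocycle m d [::] = 0.
Proof. by case: d. Qed.

Lemma cobd_cocycle m d t : cobd (@cocycle m d) t = 0.
Proof.
case: d => [|d]; last exact: cobd_cobd.
case: t => [//|x [|y t]] /=; first by rewrite subrr.
rewrite cobdE [X in _ - (_ - X)]big1; last by move=> i _; rewrite mulr0.
by case: t => [|z t] /=; rewrite ?subr0 ?subrr.
Qed.

(** In degree 0 the norm of the constant 1 is [p], which vanishes in ['F_p]. Above that, [period]
    commutes with [cobd] and undoes the lift, leaving the coboundary of the previous cocycle;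
    compatibility passes to the sublists involved. *)
Lemma period_cocycle m d t : compatible (mem t) -> period d.+1 (@cocycle m d) t = 0.
Proof.
elim: d t => [|d IH] t ct.
  rewrite /period /= -(sum_Fp (fun a => (size (map (shiftv a) t) == 1%N)%:R)).
  under eq_bigr do rewrite size_map.
  by rewrite sumr_const card_ord (mulrn_pchar (pchar_Fp p_prime)).
have -> : period d.+2 (cocycle d.+1) t =
  period d (@cocycle m d.+1) t by rewrite /period /= negbK.
rewrite period_cobd -[RHS](cobd_cocycle d t); apply: eq_cobd_subseq => s st.
apply: period_period_lift => //; first exact: cocycle_nil.
by move=> x y /= xs ys; apply: ct; rewrite /= (mem_subseq st).
Qed.

Lemma period_lift_cocycle m d t : compatible (mem t) ->
  period d (period_lift d (@cocycle m d)) t = cocycle d t.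
Proof. by apply: period_period_lift; [exact: cocycle_nil|exact: period_cocycle]. Qed.

Lemma alternating_period_lift m d (u : seq ('I_m * 'F_p) -> 'F_p) :
  alternating u -> alternating (period_lift d u).
Proof.
move=> [ua uv]; split => [l x y r|l x r]; rewrite /period_lift.
  have -> : [set z in l ++ [:: y, x & r]] = [set z in l ++ [:: x, y & r]].
    by apply/setP => z; rewrite !inE !mem_cat !inE; congr (_ || _); rewrite orbCA.
  case: odd; first by rewrite ua; case: eqP => // _; rewrite oppr0.
  by rewrite -sumrN; apply: eq_bigr => i _; rewrite !map_cat /= ua.
case: odd; first by rewrite uv if_same.
by rewrite big1 // => i _; rewrite map_cat /= uv.
Qed.

Lemma alternating_cocycle m d : alternating (@cocycle m d).
Proof.
elim: d => [|d IH] /=; last exact/alternating_cobd/alternating_period_lift.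
by split => [l x y r|l x r]; rewrite !size_cat /= !addnS ?oppr0.
Qed.

Lemma cocycle_eq0 m d t : compatible (mem t) -> (m < size t)%N -> @cocycle m d t = 0.
Proof.
move=> ct mt; apply: alternating_dup; first exact: alternating_cocycle.
apply/negP => ut; have : uniq (map fst t) by rewrite map_inj_in_uniq.
move/card_uniqP; rewrite size_map => e.
by have := max_card (mem (map fst t)); rewrite e card_ord leqNgt mt.
Qed.

End Labels.

(** * Chains on the join of copies of Z/p *)

Section Resolution.
Variables (p k : nat).
Hypothesis p_prime : prime p.

Let V := ('I_k.+1 * 'F_p)%type.

(* [join_chain d phi] is the value of [phi] on a chain [c_d] of the simplicial join of
   [k + 1] copies of Z/p, where [c_0] is a vertex and [c_(d+1)] is the cone
   over the cycle [period d c_d]. *)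
Fixpoint join_chain (d : nat) (phi : seq V -> 'F_p) : 'F_p :=
  if d is d'.+1 then join_chain d' (period d' (fun t => phi ((inord d, 0) :: t)))
  else phi [:: (ord0, 0)].

Definition join_simplex (d : nat) (t : seq V) :=
  [/\ size t = d.+1, uniq (map fst t) & forall x, x \in t -> (x.1 <= d)%N].

Lemma join_simplex_shift d t a : join_simplex d t -> join_simplex d (map (shiftv a) t).
Proof.
move=> [st ut lt]; split; first by rewrite size_map.
  by rewrite -map_comp.
by move=> _ /mapP[x xt ->]; exact: (lt x).
Qed.

Lemma eq_join_chain d phi psi : (d <= k)%N ->
  (forall t, join_simplex d t -> phi t = psi t) -> join_chain d phi = join_chain d psi.
Proof.
elim: d phi psi => [|d IH] phi psi dk e /=.
  by apply: e; split => // x; rewrite inE => /eqP ->.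
apply: IH; first exact: ltnW.
have h t : join_simplex d t -> phi ((inord d.+1, 0) :: t) = psi ((inord d.+1, 0) :: t).
  move=> [st ut lt]; apply: e; split => /=; first by rewrite st.
    rewrite ut andbT; apply/mapP => -[x xt e]; have := lt _ xt.
    by rewrite -e inordK // ltnn.
  move=> x; rewrite inE => /orP[/eqP ->|/lt/leqW //]; by rewrite inordK.
move=> t tP; rewrite /period; case: odd; last by rewrite !h //; exact: join_simplex_shift.
by apply: eq_bigr => a _; apply: h; exact: join_simplex_shift.
Qed.

Lemma join_chainB d phi psi : join_chain d (fun t => phi t - psi t) =
  join_chain d phi - join_chain d psi.
Proof.
elim: d phi psi => [//|d IH] phi psi /=; rewrite -IH; congr join_chain.
apply: funext => t; rewrite /period; case: odd; last by ring.
by rewrite sumrB.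
Qed.

Lemma join_chain0 d : join_chain d (fun=> 0) = 0.
Proof.
elim: d => [//|d IH] /=; rewrite -[RHS]IH; congr join_chain; apply: funext => t.
by rewrite /period subr0 big1 ?if_same.
Qed.

Lemma periodB d (u v : seq V -> 'F_p) t : period d (fun s => u s - v s) t =
  period d u t - period d v t.
Proof. by rewrite /period; case: odd; [rewrite sumrB|ring]. Qed.

(** The boundary of a cone over a cycle is that cycle. That [period d c_d] is a cycle follows by
    induction: its boundary is [period d] after [period d.+1], up to order, applied to the previous
    chain, and consecutive differentials compose to zero. *)
Lemma join_chain_cobd d phi : join_chain d.+1 (cobd phi) = join_chain d (period d phi).
Proof.
have -> : join_chain d.+1 (cobd phi) =
  join_chain d (period d phi) - join_chain d (period d (cobd (fun s => phi ((inord d.+1,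
    0) :: s)))).
  by rewrite -join_chainB /=; congr join_chain; apply: funext => t; rewrite -periodB.
suff -> psi : join_chain d (period d (cobd psi)) = 0 by rewrite subr0.
elim: d psi {phi} => [|d IH] psi; first by rewrite /= /period /= subrr.
have -> : period d.+1 (cobd psi) = cobd (period d.+1 psi) by apply: funext => t;
  exact: period_cobd.
have -> : join_chain d.+1 (cobd (period d.+1 psi)) =
  join_chain d (period d (period d.+1 psi))
    - join_chain d (period d (cobd (fun s => period d.+1 psi ((inord d.+1, 0) :: s)))).
  by rewrite -join_chainB /=; congr join_chain; apply: funext => t; rewrite -periodB.
rewrite IH subr0 -[RHS](join_chain0 d); congr join_chain; apply: funext => t;
  exact: period_period.
Qed.

End Resolution.

(** * A Tucker lemma for Z/p *)

Lemma mx_norm_le (R : realType) m n (x : 'M[R]_(m, n)) c :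
  0 <= c -> (forall i j, `|x i j| <= c) -> `|x| <= c.
Proof.
move=> c0 h; rewrite /Num.Def.normr /= mx_normrE.
by apply: bigmax_le => // -[i j] _; exact: h.
Qed.

Lemma mx_entry_norm (R : realType) m n (x : 'M[R]_(m, n)) i j : `|x i j| <= `|x|.
Proof.
rewrite [leRHS]/Num.Def.normr /= mx_normrE.
by apply/bigmax_geP; right => /=; exists (i, j).
Qed.

Section Join.
Variables (R : realType) (p : nat) (m : nat).

Notation V := ('I_m.+1 * 'F_p)%type.
Notation E := 'M[R]_(m.+1, (Zp_trunc (pdiv p)).+2).

(** The closed simplex spanned by [S]. Rows index the copies of Z/p and columns its elements; the
    join is the union of the faces with [S] compatible. *)
Definition face (S : {set V}) (x : E) : Prop :=
  [/\ forall i j, 0 <= x i j, \sum_i \sum_j x i j = 1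
    & forall i j, x i j != 0 -> (i, j) \in S].

Definition shiftm (a : 'F_p) (x : E) : E := \matrix_(i, j) x i (j - a).

Lemma shiftmD a b x : shiftm a (shiftm b x) = shiftm (a + b) x.
Proof.
by apply/matrixP => i j; rewrite !mxE -addrA -opprD.
Qed.

Lemma shiftm0 x : shiftm 0 x = x.
Proof. by apply/matrixP => i j; rewrite !mxE subr0. Qed.

Lemma face_shift (S : {set V}) a x : face S x ->
  face [set v | shiftv (- a) v \in S] (shiftm a x).
Proof.
move=> [x0 x1 xS]; split => [i j||i j]; rewrite ?mxE //.
  rewrite -[RHS]x1; apply: eq_bigr => i _.
  rewrite (reindex_inj (addIr a)); apply: eq_bigr => j _.
  by rewrite mxE addrK.
by move=> /xS; rewrite inE.
Qed.

(** Iterated cone coordinates, mapping a cube onto the simplex [vs]. Coordinate [i] equal to [N]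
    removes vertex [i], giving a facet; equal to 0 it makes all later coordinates irrelevant, so
    that this face of the cube collapses. *)
Fixpoint grid_point (N : nat) (vs : seq V) (y : seq nat) : E :=
  if vs is v :: vs' then
    if y is a :: y' then
      (1 - a%:R / N%:R) *: delta_mx v.1 v.2 + (a%:R / N%:R) *: grid_point N vs' y'
    else delta_mx v.1 v.2
  else 0.

Variable N : nat.
Hypothesis N0 : (0 < N)%N.

Let NR0 : N%:R != 0 :> R. Proof. by rewrite pnatr_eq0 -lt0n. Qed.

Lemma grid_point_ins_top i vs y : (i <= size y)%N -> (i < size vs)%N ->
  grid_point N vs (insert_at i N y) = grid_point N (delete_at i vs) y.
Proof.
elim: i vs y => [|i IH] [|v vs] [|a y] //= iy ivs.
- by rewrite divff // subrr scale0r scale1r add0r /delete_at /= drop0.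
- by rewrite divff // subrr scale0r scale1r add0r /delete_at /= drop0.
- by rewrite IH.
Qed.

Lemma grid_point_ins0 i vs y : (i <= size y)%N -> (i < size vs)%N ->
  grid_point N vs (insert_at i 0 y) = grid_point N (take i.+1 vs) (take i y).
Proof.
elim: i vs y => [|i IH] [|v vs] [|a y] //= iy ivs.
- by rewrite mul0r subr0 scale0r scale1r addr0.
- by rewrite mul0r subr0 scale0r scale1r addr0.
- by rewrite IH.
Qed.

Lemma grid_point_shift vs y a : grid_point N (map (shiftv a) vs) y =
  shiftm a (grid_point N vs y).
Proof.
have dS v : delta_mx v.1 (v.2 + a) = shiftm a (delta_mx v.1 v.2).
  by apply/matrixP => i j; rewrite !mxE subr_eq.
elim: vs y => [|v vs IH] [|b y] /=; rewrite ?dS //.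
- by apply/matrixP => i j; rewrite !mxE.
- by apply/matrixP => i j; rewrite !mxE.
- by rewrite IH; apply/matrixP => i j; rewrite !mxE.
Qed.

Lemma coef_ge0_le1 a : (a <= N)%N -> 0 <= a%:R / N%:R :> R /\ a%:R / N%:R <= 1 :> R.
Proof.
move=> aN; split; first by rewrite divr_ge0.
by rewrite ler_pdivrMr ?mul1r ?ler_nat // ltr0n.
Qed.

Lemma face_grid_point vs y : (size y < size vs)%N -> all (fun a => a <= N)%N y ->
  face [set v in vs] (grid_point N vs y).
Proof.
have dface (v : V) (S : {set V}) : v \in S -> face S (delta_mx v.1 v.2).
  move=> vS; split => [i j||i j]; rewrite ?mxE //.
    rewrite (bigD1 v.1) //= (bigD1 v.2) //= mxE !eqxx /= big1 ?addr0; last first.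
      by move=> j jv; rewrite mxE (negbTE jv) andbF.
    rewrite big1 ?addr0 // => i iv; rewrite big1 // => j _.
    by rewrite mxE (negbTE iv).
  rewrite pnatr_eq0 eqb0 negbK => /andP[/eqP -> /eqP ->].
  by rewrite -surjective_pairing.
elim: vs y => [//|v vs IH] [|a y] /=.
  by move=> _ _; apply: dface; rewrite !inE eqxx.
rewrite ltnS => svs /andP[aN ayN].
have [a0 a1] := coef_ge0_le1 aN.
have [x0 x1 xS] := IH y svs ayN; have [d0 d1 dS] := dface v [set v] (set11 v).
split => [i j||i j]; rewrite ?mxE.
- by rewrite addr_ge0 // mulr_ge0 ?subr_ge0 //; move: (d0 i j); rewrite mxE.
- under eq_bigr => i _.
    under eq_bigr => j _ do rewrite !mxE.
    rewrite big_split /= -!mulr_sumr.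
    over.
  rewrite big_split /= -!mulr_sumr x1.
  have -> : \sum_i \sum_j ((i == v.1) && (j == v.2))%:R = 1 :> R.
    by rewrite -[RHS]d1; apply: eq_bigr => i _; apply: eq_bigr => j _; rewrite mxE.
  by rewrite !mulr1 subrK.
- apply: contraNT; rewrite !inE negb_or => /andP[ne nvs].
  have -> : grid_point N vs y i j = 0.
    by apply/eqP; apply: contraNT nvs => /xS; rewrite inE.
  have -> : (i == v.1) && (j == v.2) = false.
    by apply/negP => /andP[/eqP ei /eqP ej]; move: ne;
      rewrite ei ej -surjective_pairing eqxx.
  by rewrite !mulr0 addr0.
Qed.

Lemma norm_delta_le1 (v : V) : `|delta_mx v.1 v.2 : E| <= 1.
Proof.
apply: mx_norm_le => // i j; rewrite mxE.
by case: (_ && _); rewrite ?normr1 ?normr0.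
Qed.

Lemma norm_grid_point_le1 vs y : all (fun a => a <= N)%N y -> `|grid_point N vs y| <= 1.
Proof.
elim: vs y => [|v vs IH] [|a y] /=; rewrite ?normr0 ?norm_delta_le1 //.
move=> /andP[aN yN]; have [a0 a1] := coef_ge0_le1 aN.
apply: le_trans (ler_normD _ _) _; rewrite !normrZ !ger0_norm ?subr_ge0 //.
rewrite -[leRHS](subrK (a%:R / N%:R)) lerD //.
  by rewrite ler_piMr ?subr_ge0 // norm_delta_le1.
by rewrite ler_piMr // IH.
Qed.

(** Changing one cone parameter by at most [1 / N] moves the point by at most [2 / N], since all
    points involved have norm at most 1; the inner contributions are only scaled down. *)
Lemma dist_grid_point vs y y' : all (fun a => a <= N)%N y -> all (fun a => a <= N)%N y' ->
  close y y' -> close y' y -> `|grid_point N vs y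
    - grid_point N vs y'| <= (size y).*2%:R / N%:R.
Proof.
elim: vs y y' => [|v vs IH] [|a y] [|a' y'] /=; rewrite ?subrr ?normr0 ?divr_ge0 //;
  try by move=> ? ? [].
move=> /andP[aN yN] /andP[aN' yN'] [[s] c] [_ c'].
have {}IH := IH y y' yN yN'.
have {}IH : `|grid_point N vs y - grid_point N vs y'| <= (size y).*2%:R / N%:R.
  by apply: IH; split => // i; [exact: (c i.+1)|exact: (c' i.+1)].
have [a0 a1] := coef_ge0_le1 aN.
have aa : `|a%:R / N%:R - a'%:R / N%:R| <= N%:R^-1 :> R.
  rewrite -mulrBl normrM [`|N%:R^-1|]ger0_norm ?invr_ge0 // ler_piMl ?invr_ge0 //.
  move: (c 0) (c' 0) => /=; rewrite -(ler_nat R) -[in X in _ -> X](ler_nat R) -!natr1.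
  by rewrite ler_norml; lra.
set s0 := a%:R / N%:R in a0 a1 aa *; set s1 := a'%:R / N%:R in aa *.
have -> : (1 - s0) *: delta_mx v.1 v.2 + s0 *: grid_point N vs y -
  ((1 - s1) *: delta_mx v.1 v.2 + s1 *: grid_point N vs y') =
  (s0 - s1) *: (- delta_mx v.1 v.2) + (s0
    - s1) *: grid_point N vs y' + s0 *: (grid_point N vs y - grid_point N vs y').
  by apply/matrixP => i j; rewrite !mxE; ring.
apply: le_trans (ler_normD _ _) _.
rewrite doubleS -[_.*2.+2]addn2 natrD addrC mulrDl lerD //.
  by rewrite normrZ ger0_norm // (le_trans _ IH) // ler_piMl.
apply: le_trans (ler_normD _ _) _; rewrite mulrDl mul1r !normrZ normrN.
have nn : 0 <= N%:R^-1 :> R by rewrite invr_ge0.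
rewrite lerD // (le_trans _ aa) // ler_piMr //.
  exact: norm_delta_le1.
exact: norm_grid_point_le1.
Qed.

End Join.

(** * Stokes on a subdivided simplex *)

Section Evaluation.
Variables (R : realType) (p : nat) (m : nat) (N : nat).
Hypothesis N0 : (0 < N)%N.

Notation V := ('I_m.+1 * 'F_p)%type.
Notation E := 'M[R]_(m.+1, (Zp_trunc (pdiv p)).+2).

(* The value of the pulled back cochain [u] on the subdivided simplex [vs]. *)
Definition eval_simplex (F : comNzRingType) (L : Type) (l : E ->
  L) (vs : seq V) (u : seq L -> F) : F :=
  grid_chain N (size vs).-1 (fun ys => u (map (fun y => l (grid_point R N vs y)) ys)).

Lemma size_delete_at (A : Type) i (t : seq A) : (i < size t)%N -> size (delete_at i t) =
  (size t).-1.
Proof. by move=> it; rewrite /delete_at size_cat size_takel ?size_drop; lia. Qed.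

(** The upper faces of the cube are all facets of the simplex but the one missing the last vertex.
    This one is the lower face in the last direction; the other lower faces are collapsed. *)
Lemma eval_simplex_cobd (F : comNzRingType) (L : Type) (l : E -> L) vs (u : seq L -> F) :
  alternating u -> (1 < size vs)%N -> eval_simplex l vs (cobd u) =
    cobd (fun ws => eval_simplex l ws u) vs.
Proof.
move=> [_ uV]; case e : (size vs) => [//|[//|k]] _.
have szy ys y : grid_simplex N k ys -> y \in ys -> size y = k by case=> _ h _ /h[].
rewrite /eval_simplex e -[k.+2.-1]/k.+1.
under [X in grid_chain _ _ X]funext => ys do rewrite cobd_map.
rewrite grid_chain_cobd cobdE e big_ord_recr /= [in RHS]big_ord_recr /= [in
  RHS]big_ord_recr /=.
have top i : (i < k.+1)%N ->
    grid_chain N k (fun s => u (map (fun y => l (grid_point R N vs y)) (map (insert_at i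
      N) s))) =
    grid_chain N (size (delete_at i vs)).-1 (fun ys => u (map (fun y => l (grid_point R N
      (delete_at i vs) y)) ys)).
  move=> ik; rewrite size_delete_at ?e; last by lia.
  apply: eq_grid_chain => ys ysP; congr u; rewrite -map_comp;
    apply/eq_in_map => y /(szy _ _ ysP) sy /=.
  by rewrite grid_point_ins_top // ?sy ?e; lia.
have bot i : (i < k.+1)%N ->
    grid_chain N k (fun s => u (map (fun y => l (grid_point R N vs y)) (map (insert_at i
      0) s))) =
    grid_chain N k (fun ys => u (map (fun y => l (grid_point R N (take i.+1 vs) (take i
      y))) ys)).
  move=> ik; apply: eq_grid_chain => ys ysP; congr u; rewrite -map_comp.
  apply/eq_in_map => y /(szy _ _ ysP) sy /=.
  by rewrite grid_point_ins0 // ?sy ?e; lia.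
rewrite top // bot // -addrA; congr (_ + _).
  apply: eq_bigr => i _; rewrite top ?bot; try by apply: ltnW; rewrite ltnS.
  (* For [i < k] the lower face depends on the first [i] of its [k] coordinates only, so labels
     repeat and alternation gives zero. *)
  rewrite (_ : grid_chain N k _ = 0) ?subr0 //.
  apply: (@grid_chain_degenerate _ _ _ i) => // a y y' r yy'.
  by rewrite !map_cat /= yy' uV.
(* The remaining lower face, [i = k], keeps the first [k + 1] vertices; its extra sign is the one of
   deleting vertex [k + 1]. *)
rewrite mulrBr; congr (_ + _).
rewrite exprS mulN1r mulNr; congr (- (_ * _)).
have -> : delete_at k.+1 vs = take k.+1 vs by rewrite /delete_at drop_oversize ?cats0 // e.
rewrite size_takel ?e //=; apply: eq_grid_chain => ys ysP; congr u.
by apply/eq_in_map => y /(szy _ _ ysP) sy; rewrite (@take_oversize _ _ y) // sy.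
Qed.

End Evaluation.

Section Tucker.
Variables (R : realType) (p : nat) (k : nat) (N : nat).
Hypotheses (p_prime : prime p) (N0 : (0 < N)%N).

Notation V := ('I_k.+1 * 'F_p)%type.
Notation E := 'M[R]_(k.+1, (Zp_trunc (pdiv p)).+2).

(** By Stokes and the boundary formula for the chains, the value of [cocycle d.+1] on [c_(d+1)] is
    that of [period_lift d (cocycle d)] on [period d c_d]. Equivariance of [l] moves [period d] onto
    the cochain, where it cancels the lift because the labels of a small cell are compatible. *)
Lemma Zp_tucker (l : E -> 'I_k * 'F_p) :
  (forall (S : {set V}) x, compatible (mem S) -> face S x -> l (shiftm 1 x) =
    shiftv 1 (l x)) ->
  (forall (S : {set V}) x y, compatible (mem S) -> face S x -> face S y ->
     `|x - y| <= k.*2%:R / N%:R -> (l x).1 = (l y).1 -> l x = l y) ->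
  False.
Proof.
move=> leq lC.
have lshift a (S : {set V}) x : compatible (mem S) -> face S x -> l (shiftm a x) =
  shiftv a (l x).
  rewrite -[a]natr_Zp; elim: (nat_of_ord a) => [|i IH] cS Sx.
    by rewrite shiftm0 shiftv0.
  rewrite -natr1 addrC -shiftmD -shiftvD -IH //.
  apply: leq (face_shift _ Sx) => u v /=; rewrite !inE => uS vS uv.
  by apply: (@shiftv_inj _ _ (- i%:R)); apply: cS.
have Mc d (vs : seq V) : join_simplex d vs -> compatible (mem [set v in vs]).
  move=> [_ uvs _] x y /=; rewrite !inE => xs ys e.
  have [ix iy] := (index_mem x vs, index_mem y vs).
  rewrite -[x](nth_index x xs) -[y](nth_index x ys); congr nth; apply/eqP.
  rewrite -(nth_uniq x.1 _ _ uvs) ?size_map ?index_mem //.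
  by rewrite !(nth_map x) ?index_mem // !nth_index // e.
have fpt d (vs : seq V) ys y : join_simplex d vs -> grid_simplex N d ys -> y \in ys ->
    face [set v in vs] (grid_point R N vs y).
  by move=> [svs _ _] [_ ysP _] /ysP[sy yN]; apply: face_grid_point => //; rewrite svs sy.
pose phi d (vs : seq V) := eval_simplex N l vs (cocycle (m := k) (p := p) d).
suff M1 d : (d <= k)%N -> join_chain d (phi d) = 1.
  have := M1 k (leqnn k); rewrite (eq_join_chain (psi := fun=> 0)) // ?join_chain0;
    last first.
    move=> vs vsP; have [svs uvs lvs] := vsP; rewrite /phi /eval_simplex svs.
    apply: grid_chain_eq0 => ys ysP; have [sys eys cys] := ysP.
    apply: cocycle_eq0; last by rewrite size_map sys.
    move=> _ _ /mapP[y yys ->] /mapP[z zys ->] /=.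
    apply: (lC [set v in vs]); [exact: Mc vsP|exact: (fpt k _ ys)|exact: (fpt k _ ys)|].
    have [/= sy yN] := eys _ yys; rewrite -[X in X.*2]sy.
    by apply: dist_grid_point => //; [case: (eys _ zys)|exact: cys|exact: cys].
  by move/esym/eqP; rewrite oner_eq0.
elim: d => [|d IH] dk; first by rewrite /phi /eval_simplex.
rewrite (eq_join_chain (psi := cobd (fun vs => eval_simplex N l vs (period_lift d
  (cocycle (m := k) d))))) //; last first.
  move=> vs [svs _ _]; apply: eval_simplex_cobd => //; last by rewrite svs.
  exact/alternating_period_lift/alternating_cocycle.
rewrite join_chain_cobd -[RHS](IH (ltnW dk)); apply: eq_join_chain; first exact: ltnW.
move=> vs vsP; have [svs _ _] := vsP.
have Esh a u : eval_simplex N l (map (shiftv a) vs) u =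
  eval_simplex N l vs (fun t => u (map (shiftv a) t)).
  rewrite /eval_simplex size_map svs; apply: eq_grid_chain => ys ysP; congr u;
    rewrite -map_comp.
  apply/eq_in_map => y yys /=; rewrite grid_point_shift (lshift _ [set v in vs]) //.
    exact: Mc vsP.
  exact: fpt ysP _.
transitivity (eval_simplex N l vs (period d (period_lift d (cocycle (m := k) d)))).
  rewrite /period; case: (odd d); last by rewrite Esh /eval_simplex grid_chainB.
  by under eq_bigr do rewrite Esh; rewrite /eval_simplex grid_chain_sum.
rewrite /phi /eval_simplex svs; apply: eq_grid_chain => ys ysP; have [sys eys cys] := ysP.
apply: period_lift_cocycle => // _ _ /mapP[y yys ->] /mapP[z zys ->] /=.
apply: (lC [set v in vs]); [exact: Mc vsP|exact: (fpt d _ ys)|exact: (fpt d _ ys)|].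
have [/= sy yN] := eys _ yys.
apply: (@le_trans _ _ ((size y).*2%:R / N%:R)).
  by apply: dist_grid_point => //; [case: (eys _ zys)|exact: cys|exact: cys].
by rewrite ler_pM2r ?invr_gt0 ?ltr0n // ler_nat leq_double sy ltnW.
Qed.

End Tucker.

Local Open Scope classical_set_scope.
Local Open Scope ring_scope.

(** * Extension of maps along skeleta *)

Section ContinuityOnSets.
Implicit Types T U W : topologicalType.

(** Continuity of the restriction in filter form: maps keep their ambient type, and restriction and
    composition are operations on filters. *)
Definition cont_on T U (A : set T) (f : T -> U) :=
  forall x, A x -> f y @[y --> within A (nbhs x)] --> f x.

Lemma cont_onP T U (A : set T) (f : T -> U) :
  {within A, continuous f} <-> cont_on A f.
Proof. exact: subspace_continuousP. Qed.

Lemma continuous_cont_on T U (A : set T) (f : T -> U) :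
  continuous f -> cont_on A f.
Proof. by move=> cf x _; apply: cvg_within_filter; exact: cf. Qed.

Lemma cont_onT T U (f : T -> U) : cont_on setT f -> continuous f.
Proof.
move=> cf x O /(cf x I); rewrite /nbhs /= /within /=.
by apply: filterS => y; exact.
Qed.

Lemma cont_on_comp T U W (A : set T) (B : set U) (f : T -> U) (g : U -> W) :
  cont_on A f -> (forall x, A x -> B (f x)) -> cont_on B g ->
  cont_on A (fun x => g (f x)).
Proof.
move=> cf fAB cg x Ax O /(cg _ (fAB _ Ax)).
rewrite /nbhs /= /within /= => gO.
have := cf x Ax _ gO; rewrite /nbhs /= /within /=.
by apply: filterS => y h Ay; apply: (h Ay); exact: fAB.
Qed.

Lemma cont_on_subset T U (A B : set T) (f : T -> U) :
  A `<=` B -> cont_on B f -> cont_on A f.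
Proof.
move=> AB cf x Ax O /(cf _ (AB _ Ax)).
by rewrite /nbhs /= /within /=; apply: filterS => y h Ay; apply/h/AB.
Qed.

Lemma eq_cont_on T U (A : set T) (f g : T -> U) :
  (forall x, A x -> f x = g x) -> cont_on A f -> cont_on A g.
Proof.
move=> fg cf x Ax O; rewrite -(fg _ Ax) => /(cf _ Ax).
rewrite /nbhs /= /within /=; apply: filterS => y h Ay; rewrite -fg //; exact: h.
Qed.

Lemma cont_on_cst T U (A : set T) (c : U) : cont_on A (fun=> c).
Proof. by move=> x _; exact: cvg_cst. Qed.

Lemma cont_onU T U (A B : set T) (f : T -> U) :
  closed A -> closed B -> cont_on A f -> cont_on B f -> cont_on (A `|` B) f.
Proof. by move=> cA cB /cont_onP fA /cont_onP fB; apply/cont_onP/withinU_continuous. Qed.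

Lemma cont_on_bigU T U (I : finType) (P : pred I) (A : I -> set T) (f : T -> U) :
  (forall i, closed (A i)) -> (forall i, P i -> cont_on (A i) f) ->
  cont_on [set x | exists2 i, P i & A i x] f.
Proof.
move=> cA cf.
have -> : [set x | exists2 i, P i & A i x] = \big[setU/set0]_(i <- enum P) A i.
  rewrite -bigcup_seq; apply/seteqP; split => x /=.
    by move=> [i Pi Aix]; exists i => //=; rewrite mem_enum.
  by move=> [i /=]; rewrite mem_enum => Pi Aix; exists i.
suff : cont_on (\big[setU/set0]_(i <- enum P) A i) f /\
       closed (\big[setU/set0]_(i <- enum P) A i) by case.
have : forall i, i \in enum P -> P i by move=> i; rewrite mem_enum.
elim: (enum P) => [|i r IH] rP; first by rewrite big_nil; split; [move=> x|exact: closed0].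
have [] := IH; first by move=> j jr; apply: rP; rewrite inE jr orbT.
rewrite big_cons => c1 c2; split; last exact: closedU.
by apply: cont_onU => //; apply: cf; apply: rP; rewrite inE eqxx.
Qed.

Lemma cont_on_mx (R : realType) T (A : set T) m n (f : T -> 'M[R]_(m, n)) :
  (forall i j, cont_on A (fun x => f x i j)) -> cont_on A f.
Proof.
move=> cf x Ax; apply/cvgrPdist_lt => e e0.
have : \forall y \near within A (nbhs x), forall i j, `|f x i j - f y i j| < e / 2.
  apply: filter_forall => i; apply: filter_forall => j.
  by move/cvgrPdist_lt : (cf i j x Ax); apply; rewrite divr_gt0.
apply: filterS => y h.
have e2 : e / 2 < e by rewrite ltr_pdivrMr // ltr_pMr // ltr1n.
apply: le_lt_trans e2; apply: mx_norm_le; first by rewrite divr_ge0 // ltW.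
by move=> i j; rewrite !mxE ltW.
Qed.

Lemma cont_on_scale (R : realType) T (A : set T) m n (c : T -> R) (f : T -> 'M[R]_(m, n)) :
  cont_on A c -> cont_on A f -> cont_on A (fun x => c x *: f x).
Proof. by move=> cc cf x Ax; apply: cvgZ; [exact: cc|exact: cf]. Qed.

Lemma cont_onM (R : realType) T (A : set T) (f g : T -> R) :
  cont_on A f -> cont_on A g -> cont_on A (fun x => f x * g x).
Proof. by move=> cf cg x Ax; apply: cvgM; [exact: cf|exact: cg]. Qed.

Lemma cont_onB (R : realType) T (A : set T) (f g : T -> R) :
  cont_on A f -> cont_on A g -> cont_on A (fun x => f x - g x).
Proof. by move=> cf cg x Ax; apply: cvgB; [exact: cf|exact: cg]. Qed.

Lemma cont_on_sum (R : realType) T (A : set T) (I : Type) (r : seq I) (f : I -> T -> R) :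
  (forall i, cont_on A (f i)) -> cont_on A (fun x => \sum_(i <- r) f i x).
Proof.
move=> cf; elim: r => [|i r IH].
  by under [fun _ => _]funext do rewrite big_nil; exact: cont_on_cst.
under [fun _ => _]funext do rewrite big_cons.
by move=> x Ax; apply: cvgD; [exact: cf|exact: IH].
Qed.

Lemma cont_onV (R : realType) T (A : set T) (f : T -> R) :
  (forall x, A x -> f x != 0) -> cont_on A f -> cont_on A (fun x => (f x)^-1).
Proof. by move=> f0 cf x Ax; apply: cvgV; [exact: f0|exact: cf]. Qed.

Lemma cont_on_sqrt (R : realType) T (A : set T) (f : T -> R) :
  cont_on A f -> cont_on A (fun x => Num.sqrt (f x)).
Proof.
move=> cf; apply: (cont_on_comp (B := setT)) => //.
exact/continuous_cont_on/sqrt_continuous.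
Qed.

Lemma cont_on_norm (R : realType) T (A : set T) m n (f : T -> 'M[R]_(m, n)) :
  cont_on A f -> cont_on A (fun x => `|f x|).
Proof.
move=> cf; apply: (cont_on_comp (B := setT)) => //.
exact/continuous_cont_on/norm_continuous.
Qed.

Lemma cont_on_coord (R : realType) (m n : nat) (A : set 'M[R]_(m, n)) i j :
  cont_on A (fun x => x i j).
Proof. by apply: continuous_cont_on; exact: coord_continuous. Qed.

Lemma cont_on_pair T U W (A : set T) (f : T -> U) (g : T -> W) :
  cont_on A f -> cont_on A g -> cont_on A (fun x => (f x, g x)).
Proof. by move=> cf cg x Ax; apply: cvg_pair; [exact: cf|exact: cg]. Qed.

Lemma closed_le (R : realType) T (f g : T -> R) :
  continuous f -> continuous g -> closed [set x | f x <= g x].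
Proof.
move=> cf cg.
have -> : [set x | f x <= g x] = (fun x => g x - f x) @^-1` [set y | 0 <= y].
  by apply/seteqP; split => x /=; rewrite subr_ge0.
apply: closed_comp; last exact: closed_ge.
by move=> x _; apply: cvgB; [exact: cg|exact: cf].
Qed.

Lemma closed_eqr (R : realType) T (f g : T -> R) :
  continuous f -> continuous g -> closed [set x | f x = g x].
Proof.
move=> cf cg.
have -> : [set x | f x = g x] = [set x | f x <= g x] `&` [set x | g x <= f x].
  apply/seteqP; split => x /=; first by move=> ->; rewrite lexx.
  by move=> [fg gf]; apply/eqP; rewrite eq_le fg.
by apply: closedI; exact: closed_le.
Qed.

Lemma closed_all T (I : Type) (A : I -> set T) :
  (forall i, closed (A i)) -> closed [set x | forall i, A i x].
Proof.
move=> cA; have -> : [set x | forall i, A i x] = \bigcap_(i in setT) A i.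
  by apply/seteqP; split => x /= h i => [_|]; exact: h.
exact: closed_bigI.
Qed.

Lemma closed_impl T (b : bool) (A : set T) : closed A -> closed [set x | b -> A x].
Proof.
move=> cA; case: b.
  by rewrite (_ : mkset _ = A) //; apply/seteqP; split => x /=; [exact|].
by rewrite (_ : mkset _ = setT); [exact: closedT|apply/seteqP; split].
Qed.

End ContinuityOnSets.

(** * The simplex as a cone over a sphere *)

Section SimplexSphere.
Variable R : realType.

Definition simplex n : set 'rV[R]_n :=
  [set x | (forall i, 0 <= x ord0 i) /\ \sum_i x ord0 i = 1].

Definition simplex_bd n : set 'rV[R]_n :=
  [set x | simplex x /\ exists i, x ord0 i = 0].

(* The least coordinate, for vectors with coordinates at most [1]: expressing
   it with the sup norm makes its continuity immediate. *)
Definition mincoord n (x : 'rV[R]_n) : R := 1 - `|const_mx 1 - x|.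

Lemma sub_const_mxE m n (x : 'M[R]_(m, n)) c i j : (x - const_mx c) i j = x i j - c.
Proof. by rewrite !mxE. Qed.

Lemma mincoord_le n (x : 'rV[R]_n) i :
  (forall i, x ord0 i <= 1) -> mincoord x <= x ord0 i.
Proof.
move=> x1; rewrite /mincoord; have := mx_entry_norm (const_mx 1 - x) ord0 i.
by rewrite !mxE ger0_norm ?subr_ge0 //; lra.
Qed.

Lemma mincoord_attained n (x : 'rV[R]_n.+1) :
  (forall i, x ord0 i <= 1) -> exists i, x ord0 i = mincoord x.
Proof.
move=> x1; rewrite /mincoord.
have [z|nz] := eqVneq `|const_mx 1 - x| 0.
  exists ord0; rewrite z; move/normr0_eq0/matrixP: z => /(_ ord0 ord0).
  by rewrite !mxE; lra.
have [[i j] /= e] := mx_norm_neq0 nz; exists j.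
by rewrite [`|const_mx 1 - x|]e (ord1 i) !mxE ger0_norm ?subr_ge0 // opprB addrC subrK.
Qed.

Lemma mincoord_unique n (x : 'rV[R]_n) c :
  (forall i, x ord0 i <= 1) -> (forall i, c <= x ord0 i) ->
  (exists i, x ord0 i = c) -> mincoord x = c.
Proof.
move=> x1 cx [i xi]; apply/eqP; rewrite eq_le -{1}xi mincoord_le //=.
rewrite /mincoord lerBrDr -lerBrDl; apply: mx_norm_le.
  by rewrite -xi subr_ge0.
by move=> i' j; rewrite !mxE ord1 ger0_norm ?subr_ge0 // lerB.
Qed.

Lemma cont_on_mincoord (T : topologicalType) n (A : set T) (f : T -> 'rV[R]_n) :
  cont_on A f -> cont_on A (fun x => mincoord (f x)).
Proof.
move=> cf; apply: cont_onB; first exact: cont_on_cst.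
apply: cont_on_norm => x Ax; apply: cvgB; [exact: cvg_cst|exact: cf].
Qed.

Definition normalize n (x : 'rV[R]_n) := (\sum_i x ord0 i)^-1 *: x.

Definition sphere_of n (v : 'rV[R]_n) := (Num.sqrt (\sum_i v ord0 i ^+ 2))^-1 *: v.

Definition chart n (x : 'rV[R]_n.+1) : 'rV[R]_n :=
  \row_j (x ord0 (lift ord0 j) - x ord0 ord0).

Definition unchart n (u : 'rV[R]_n) : 'rV[R]_n.+1 :=
  \row_i (if unlift ord0 i is Some j then u ord0 j else 0).

(** Coordinates modulo the diagonal direction identify the sphere with the boundary of the simplex:
    [chart] quotients by the diagonal, and subtracting the least coordinate selects the
    representative on the boundary of the positive orthant, which is then scaled to sum 1. *)
Definition sphere_to_bd n (u : 'rV[R]_n) : 'rV[R]_n.+1 :=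
  normalize (unchart u - const_mx (mincoord (unchart u))).

Lemma sum_sqr_gt0 n (v : 'rV[R]_n) : v != 0 -> 0 < \sum_i v ord0 i ^+ 2.
Proof.
move=> v0; rewrite lt_neqAle sumr_ge0 ?andbT; last by move=> i _; exact: sqr_ge0.
apply: contra v0; rewrite eq_sym psumr_eq0; last by move=> i _; exact: sqr_ge0.
move=> /allP h; apply/eqP/rowP => i; rewrite mxE; apply/eqP.
by have := h i (mem_index_enum _); rewrite /= sqrf_eq0.
Qed.

Lemma sphere_ofP n (v : 'rV[R]_n) : v != 0 ->
  \sum_i (sphere_of v) ord0 i ^+ 2 = 1.
Proof.
move=> /sum_sqr_gt0 s; under eq_bigr do rewrite mxE exprMn.
by rewrite -mulr_sumr exprVn sqr_sqrtr ?ltW // mulVf // gt_eqF.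
Qed.

Lemma sphere_le1 n (u : 'rV[R]_n) i : \sum_i u ord0 i ^+ 2 = 1 -> u ord0 i <= 1.
Proof.
move=> u1; apply: le_trans (ler_norm _) _.
rewrite -(@ler_pXn2r _ 2) ?nnegrE // expr1n real_normK ?num_real // -u1.
by rewrite (bigD1 i) //= lerDl sumr_ge0 // => j _; exact: sqr_ge0.
Qed.

Lemma unchart_le1 n (u : 'rV[R]_n) i : \sum_i u ord0 i ^+ 2 = 1 -> (unchart u) ord0 i <= 1.
Proof.
by move=> u1; rewrite mxE; case: unlift => [j|]; [exact: sphere_le1|exact: ler01].
Qed.

Lemma unchart_sum_gt0 n (u : 'rV[R]_n) : \sum_i u ord0 i ^+ 2 = 1 ->
  0 < \sum_i (unchart u - const_mx (mincoord (unchart u))) ord0 i.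
Proof.
move=> u1; have ge i := mincoord_le (x := unchart u) i (fun i => unchart_le1 i u1).
rewrite lt_neqAle sumr_ge0 ?andbT; last by move=> i _; rewrite sub_const_mxE subr_ge0.
apply/negP; rewrite eq_sym psumr_eq0; last first.
  by move=> i _; rewrite sub_const_mxE subr_ge0.
move=> /allP h.
have {}h i : unchart u ord0 i = mincoord (unchart u).
  by have := h i (mem_index_enum _); rewrite /= sub_const_mxE subr_eq0 => /eqP.
have z : mincoord (unchart u) = 0 by rewrite -(h ord0) mxE unlift_none.
move: u1; rewrite big1 => [/esym/eqP|i _]; first by rewrite oner_eq0.
by have := h (lift ord0 i); rewrite z mxE liftK => ->; rewrite expr0n.
Qed.

Lemma sphere_to_bdP n (u : 'rV[R]_n) : \sum_i u ord0 i ^+ 2 = 1 ->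
  simplex_bd (sphere_to_bd u).
Proof.
move=> u1; have ge i := mincoord_le (x := unchart u) i (fun i => unchart_le1 i u1).
have s0 := unchart_sum_gt0 u1; split; first split.
- move=> i; rewrite mxE mulr_ge0 ?invr_ge0 ?(ltW s0) // sub_const_mxE subr_ge0.
  exact: ge.
- by under eq_bigr do rewrite mxE; rewrite -mulr_sumr mulVf // gt_eqF.
have [i e] := mincoord_attained (fun i => unchart_le1 i u1).
by exists i; rewrite mxE sub_const_mxE e subrr mulr0.
Qed.

Lemma cont_sphere_to_bd n :
  cont_on [set u : 'rV[R]_n | \sum_i u ord0 i ^+ 2 = 1] (@sphere_to_bd n).
Proof.
have cu : cont_on [set u : 'rV[R]_n | \sum_i u ord0 i ^+ 2 = 1] (@unchart n).
  apply: cont_on_mx => i j.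
  apply: (eq_cont_on (f := fun u : 'rV_n => if unlift ord0 j is Some k then u ord0 k else
    0)) => [u _|].
    by rewrite mxE.
  by case: unlift => [k|]; [exact: cont_on_coord|exact: cont_on_cst].
have cd : cont_on [set u : 'rV[R]_n | \sum_i u ord0 i ^+ 2 = 1]
    (fun u => unchart u - const_mx (mincoord (unchart u))).
  apply: cont_on_mx => i j.
  apply: (eq_cont_on (f := fun u => unchart u i j - mincoord (unchart u))) => [u _|].
    by rewrite sub_const_mxE.
  apply: cont_onB; last exact: cont_on_mincoord.
  apply: (cont_on_comp (B := setT) (g := fun x : 'rV_n.+1 => x i j)) => //.
  exact: cont_on_coord.
apply: cont_on_scale => //; apply: cont_onV.
  by move=> u u1; rewrite gt_eqF // unchart_sum_gt0.
apply: cont_on_sum => i.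
apply: (cont_on_comp (B := setT) (g := fun x : 'rV_n.+1 => x ord0 i)) => //.
exact: cont_on_coord.
Qed.

Lemma simplex_le1 n (x : 'rV[R]_n) i : simplex x -> x ord0 i <= 1.
Proof.
by move=> [x0 <-]; rewrite (bigD1 i) //= lerDl sumr_ge0.
Qed.

(** Since [x] has least coordinate 0, subtracting the minimum from its rescaled diagonal translate
    returns a multiple of [x]. *)
Lemma sphere_chartK n (x : 'rV[R]_n.+1) : simplex_bd x -> chart x != 0 ->
  sphere_to_bd (sphere_of (chart x)) = x.
Proof.
move=> [[x0 x1] [i xi]] cx; have u1 := sphere_ofP cx.
set u := sphere_of _ in u1 *; set c := (Num.sqrt (\sum_i (chart x) ord0 i ^+ 2))^-1.
have c0 : 0 < c by rewrite invr_gt0 sqrtr_gt0 sum_sqr_gt0.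
have eu j : unchart u ord0 j = c * (x ord0 j - x ord0 ord0).
  rewrite mxE; case: unliftP => [k ->|->]; last by rewrite subrr mulr0.
  by rewrite /u !mxE.
have em : mincoord (unchart u) = - (c * x ord0 ord0).
  apply: mincoord_unique; first by move=> j; exact: unchart_le1.
    by move=> j; rewrite eu mulrBr lerBrDr addNr mulr_ge0 // ltW.
  by exists i; rewrite eu xi sub0r mulrN.
have e : unchart u - const_mx (mincoord (unchart u)) = c *: x.
  apply/rowP => j; rewrite sub_const_mxE [RHS]mxE eu em; ring.
rewrite /sphere_to_bd e /normalize; under eq_bigr do rewrite mxE.
rewrite -mulr_sumr x1 mulr1 scalerA mulVf ?scale1r // gt_eqF //.
Qed.

Lemma chart_eq0_mincoord n (x : 'rV[R]_n.+1) : simplex x -> chart x = 0 ->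
  n.+1%:R * mincoord x = 1.
Proof.
move=> sx cx; have [x0 x1] := sx.
have e i : x ord0 i = x ord0 ord0.
  case: (unliftP ord0 i) => [j ->|-> //].
  by move/rowP: cx => /(_ j); rewrite !mxE => /eqP; rewrite subr_eq0 => /eqP.
have -> : mincoord x = x ord0 ord0.
  apply: mincoord_unique; [by move=> i; exact: simplex_le1|by move=> i; rewrite e|].
  by exists ord0.
rewrite -[RHS]x1; under [RHS]eq_bigr do rewrite e.
by rewrite sumr_const card_ord mulr_natl.
Qed.

Lemma mincoord_range n (x : 'rV[R]_n.+1) : simplex x ->
  0 <= n.+1%:R * mincoord x <= 1.
Proof.
move=> sx; have [x0 x1] := sx; have le1 i := simplex_le1 i sx.
have [i e] := mincoord_attained le1.
rewrite mulr_ge0 -?e //= -[leRHS]x1 mulr_natl.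
have -> : x ord0 i *+ n.+1 = \sum_(j < n.+1) x ord0 i by rewrite sumr_const card_ord.
by apply: ler_sum => j _; rewrite e mincoord_le.
Qed.

Lemma mincoord_bd n (x : 'rV[R]_n) : simplex_bd x -> mincoord x = 0.
Proof.
move=> [sx [i xi]]; apply: mincoord_unique; [by move=> j; exact: simplex_le1|by case: sx|].
by exists i.
Qed.

Lemma closed_simplex n : closed (@simplex n).
Proof.
apply: closedI.
  apply: closed_all => i; apply: closed_le; first exact: cst_continuous.
  exact: coord_continuous.
apply: closed_eqr; last exact: cst_continuous.
by apply: cont_onT; apply: cont_on_sum => i; exact: cont_on_coord.
Qed.

End SimplexSphere.

(** The boundary of a simplex with [k + 2] vertices is a [k]-sphere. The null homotopy is spread
    along the radial coordinate [lam], which is 0 on the boundary and 1 at the barycentre. *)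
Lemma simplex_filling (X : topologicalType) k (f : 'rV[RR]_k.+2 -> X) :
  (forall x : X, pi_trivial k x) -> cont_on (@simplex_bd _ k.+2) f ->
  exists2 g : 'rV[RR]_k.+2 -> X, cont_on (@simplex _ k.+2) g &
    forall x, simplex_bd x -> g x = f x.
Proof.
move=> piX cf.
pose s (u : 'rV[RR]_k.+1) := f (sphere_to_bd u).
have cs : {within usphere k, continuous s}.
  apply/cont_onP; apply: (cont_on_comp _ _ cf); first exact: cont_sphere_to_bd.
  by move=> u; exact: sphere_to_bdP.
have [H [/cont_onP cH H01 _]] := piX _ s cs erefl.
set x0 : X := s _ in H01.
pose lam (x : 'rV[RR]_k.+2) : RR := k.+2%:R * mincoord x.
pose g1 x := H (2 * lam x, sphere_of (chart x)).
pose A := [set x : 'rV[RR]_k.+2 | simplex x /\ lam x <= 2^-1].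
pose B := [set x : 'rV[RR]_k.+2 | simplex x /\ 2^-1 <= lam x].
have Achart x : A x -> chart x != 0.
  move=> [sx lx]; apply/negP => /eqP /(chart_eq0_mincoord sx) e.
  by move: lx; rewrite /lam e; lra.
have clam T : cont_on T lam.
  apply: cont_onM; first exact: cont_on_cst.
  by apply: cont_on_mincoord; apply: continuous_cont_on => x; exact: cvg_id.
have lamc : continuous lam by apply: (cont_onT (clam setT)).
have c1 : cont_on A g1.
  apply: (cont_on_comp (f := fun x => (2 * lam x, sphere_of (chart x))) _ _ cH).
    apply: cont_on_pair; first by apply: cont_onM; [exact: cont_on_cst|exact: clam].
    have cc : cont_on A (@chart _ k.+1).
      apply: cont_on_mx => i j.
      apply: (eq_cont_on (f := fun x : 'rV[RR]_k.+2 => x ord0 (lift ord0 j)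
        - x ord0 ord0)) => [x _|].
        by rewrite mxE.
      by apply: cont_onB; exact: cont_on_coord.
    apply: cont_on_scale => //; apply: cont_onV => [x /Achart cx0|].
      by rewrite gt_eqF // sqrtr_gt0 sum_sqr_gt0.
    apply: cont_on_sqrt; apply: cont_on_sum => i.
    apply: (eq_cont_on (f := fun x : 'rV[RR]_k.+2 => chart x ord0 i * chart x ord0 i)) =>
      [x _|].
      by rewrite expr2.
    have ci : cont_on A (fun x => chart x ord0 i).
      by apply: (cont_on_comp cc (B := setT) (g :=
        fun y : 'rV[RR]_k.+1 => y ord0 i)) => //; exact: cont_on_coord.
    exact: cont_onM.
  move=> x Ax; have [sx lx] := Ax; split; last exact/sphere_ofP/Achart.
  by have /andP[? _] := mincoord_range sx; rewrite /= /lam in lx *; lra.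
(* The homotopy is run at double speed and [g] is constant on the inner half, because the direction
   [sphere_of (chart x)] has no limit at the barycentre. *)
pose g x := if lam x <= 2^-1 then g1 x else x0.
have gB x : B x -> g x = x0.
  move=> [sx lx]; rewrite /g; case: ifP => // lx'.
  have e : lam x = 2^-1 by apply/eqP; rewrite eq_le lx lx'.
  rewrite /g1 e divff //; have [_] :=
    H01 (sphere_of (chart x)) (sphere_ofP (Achart x (conj sx lx'))).
  by apply.
exists g.
  apply: (cont_on_subset (B := A `|` B)).
    by move=> x sx; case: (leP (lam x) 2^-1) => [?|/ltW ?]; [left|right].
  apply: cont_onU.
  - apply: closedI; first exact: closed_simplex.
    by apply: closed_le => //; exact: cst_continuous.
  - apply: closedI; first exact: closed_simplex.
    by apply: closed_le => //; exact: cst_continuous.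
  - by apply: (eq_cont_on _ c1) => x [_ lx]; rewrite /g lx.
  - apply: (eq_cont_on (f := fun=> x0)) => [x /gB //|]; exact: cont_on_cst.
move=> x bx; have lx : lam x = 0 by rewrite /lam mincoord_bd // mulr0.
have Ax : A x by split; [case: bx|rewrite lx invr_ge0].
rewrite /g lx invr_ge0 ler0n /g1 lx mulr0.
have [-> _] := H01 (sphere_of (chart x)) (sphere_ofP (Achart x Ax)).
by rewrite /s sphere_chartK // Achart.
Qed.

(** * An equivariant map from the join *)

Section EquivariantMap.
Variables (p m : nat).
Hypothesis p_prime : prime p.

Notation V := ('I_m.+1 * 'F_p)%type.
Notation E := 'M[RR]_(m.+1, (Zp_trunc (pdiv p)).+2).

Lemma face_sum (S : {set V}) (x : E) : (forall i j, x i j != 0 -> (i, j) \in S) ->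
  \sum_i \sum_j x i j = \sum_(v in S) x v.1 v.2.
Proof.
move=> xS; rewrite pair_big /= [LHS](bigID (mem S)) /= [X in _ + X]big1 ?addr0 //.
move=> [i j] /= nS; apply/eqP; apply: contraNT nS; exact: xS.
Qed.

Lemma face_filling (X : topologicalType) d (S : {set V}) (f : E -> X) (x0 : X) :
  #|S| = d.+1 -> (forall e, d = e.+1 -> forall x : X, pi_trivial e x) ->
  (forall v, v \in S -> cont_on (face (S :\ v)) f) ->
  exists2 g : E -> X, cont_on (face S) g &
    forall x v, face S x -> v \in S -> x v.1 v.2 = 0 -> g x = f x.
Proof.
(* A single vertex has no boundary: its only coordinate is 1, so the agreement condition is
   vacuous. *)
case: d => [|d] cS piX cf.
  exists (fun=> x0); first exact: cont_on_cst.
  move=> x v [_ x1 xS] vS xv; move: x1; rewrite (face_sum xS).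
  have /eqP/cards1P[w Sw] := cS; move: vS; rewrite Sw big_set1 inE => /eqP e.
  by rewrite -e xv => /esym/eqP; rewrite oner_eq0.
pose n := #|S|; pose e (a : 'I_n) : V := enum_val a.
have eS a : e a \in S by exact: enum_valP.
have einj : injective e by exact: enum_val_inj.
pose inc (y : 'rV[RR]_n) : E := \matrix_(i, j) \sum_a y ord0 a *+ (e a == (i, j)).
pose res (x : E) : 'rV[RR]_n := \row_a x (e a).1 (e a).2.
have incE y a : inc y (e a).1 (e a).2 = y ord0 a.
  rewrite mxE -surjective_pairing (bigD1 a) //= eqxx mulr1n big1 ?addr0 // => b ba.
  by rewrite (inj_eq einj) (negbTE ba).
have incS (y : 'rV[RR]_n) i j : inc y i j != 0 -> exists2 a, (i, j) = e a & y ord0 a != 0.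
  have [/existsP[a /eqP ea]|no] := boolP [exists a, e a == (i, j)].
    by have := incE y a; rewrite ea /= => -> ya; exists a.
  rewrite mxE big1 ?eqxx // => a _; case: eqP => // ea.
  by move/existsP: no; case; exists a; apply/eqP.
have sumS (F : V -> RR) : \sum_(v in S) F v = \sum_a F (e a) by rewrite big_enum_val.
have incface y : simplex y -> face S (inc y).
  move=> [y0 y1]; split.
  - by move=> i j; rewrite mxE sumr_ge0 // => a _; exact: mulrn_wge0.
  - rewrite (face_sum (S := S)); last by move=> i j /incS[a -> _].
    by rewrite sumS; under eq_bigr do rewrite incE.
  - by move=> i j /incS[a -> _].
have ressimp x : face S x -> simplex (res x).
  move=> [x0' x1 xS]; split; first by move=> a; rewrite mxE.
  by under eq_bigr do rewrite mxE; rewrite -(sumS (fun v => x v.1 v.2)) -face_sum.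
have resK x : face S x -> inc (res x) = x.
  move=> [_ _ xS]; apply/matrixP => i j.
  have [ij|ij] := boolP ((i, j) \in S).
    have [a ea] : exists a, (i, j) = e a by exists (enum_rank_in ij (i, j));
      rewrite /e enum_rankK_in.
    by have := incE (res x) a; rewrite -ea /= => ->; rewrite mxE -ea.
  have -> : x i j = 0 by apply/eqP; apply: contraNT ij; exact: xS.
  by apply/eqP; apply: contraNT ij => /incS[a -> _].
have cinc A : cont_on A inc.
  apply: cont_on_mx => i j.
  apply: (eq_cont_on (f := fun y : 'rV[RR]_n => \sum_a y ord0 a *+ (e a == (i, j)))) =>
    [y _|].
    by rewrite mxE.
  apply: cont_on_sum => a; case: eqP => _; rewrite ?mulr1n; first exact: cont_on_coord.
  exact: cont_on_cst.
have cres A : cont_on A res.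
  apply: cont_on_mx => i a.
  apply: (eq_cont_on (f := fun x : E => x (e a).1 (e a).2)) => [x _|]; first by rewrite mxE.
  exact: cont_on_coord.
have cbd : cont_on (@simplex_bd _ n) (f \o inc).
  pose A (a : 'I_n) := [set y : 'rV[RR]_n | simplex y /\ y ord0 a = 0].
  apply: (cont_on_subset (B := [set y | exists2 a, predT a & A a y])).
    by move=> y [sy [a ya]]; exists a.
  apply: cont_on_bigU => a.
    apply: closedI; first exact: closed_simplex.
    by apply: closed_eqr; [exact: coord_continuous|exact: cst_continuous].
  move=> _; apply: (cont_on_comp (cinc _) _ (cf (e a) (eS a))) => y [sy ya].
  have [y0 y1 yS] := incface y sy; split => // i j ij.
  rewrite in_setD1 yS // andbT; apply/eqP => eij.
  by have := incE y a; rewrite -eij /= => z; move: ij; rewrite z ya eqxx.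
have [G cG GE] : exists2 g : 'rV[RR]_n -> X, cont_on (@simplex _ n) g &
    forall y, simplex_bd y -> g y = (f \o inc) y.
  move: (f \o inc) cbd; have -> : n = d.+2 by exact: cS.
  by move=> F cF; apply: simplex_filling => //; exact: piX.
exists (G \o res); first exact: (cont_on_comp (cres _) ressimp cG).
move=> x v fx vS xv /=; rewrite GE /= ?resK //; split; first exact: ressimp.
by exists (enum_rank_in vS v); rewrite mxE /e enum_rankK_in.
Qed.

Variables (X : topologicalType) (T : X -> X).
Hypothesis T_cont : continuous T.
Hypothesis T_order : forall x, iter p T x = x.

Definition supp_set (x : E) : {set V} := [set v | x v.1 v.2 != 0].
Definition shift_set (a : 'F_p) (S : {set V}) : {set V} := [set v | shiftv (- a) v \in S].

Lemma face_supp (S : {set V}) (x : E) : face S x -> face (supp_set x) x.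
Proof. by move=> [x0 x1 xS]; split => // i j; rewrite inE. Qed.

Lemma supp_sub (S : {set V}) (x : E) : face S x -> supp_set x \subset S.
Proof. by move=> [_ _ xS]; apply/fintype.subsetP => -[i j]; rewrite inE; exact: xS. Qed.

Lemma shift_setD a b S : shift_set a (shift_set b S) = shift_set (a + b) S.
Proof. by apply/setP => v; rewrite !inE shiftvD opprD addrC. Qed.

Lemma card_shift_set a S : #|shift_set a S| = #|S|.
Proof.
rewrite -[RHS](card_preimset S (shiftv_inj (a := - a))).
by apply: eq_card => v; rewrite !inE.
Qed.

Lemma compatible_shift a (S : {set V}) : compatible (mem S) ->
  compatible (mem (shift_set a S)).
Proof.
move=> cS x y /=; rewrite !inE => xS yS e.
by apply: (@shiftv_inj _ _ (- a)); apply: cS.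
Qed.

Lemma supp_shift a x : supp_set (shiftm a x) = shift_set a (supp_set x).
Proof. by apply/setP => v; rewrite !inE mxE. Qed.

Lemma compatible_sub (S S' : {set V}) : S' \subset S -> compatible (mem S) ->
  compatible (mem S').
Proof. by move=> /fintype.subsetP SS cS x y xS yS; apply: cS; exact: SS. Qed.

Lemma face_neq0 (S : {set V}) (x : E) : face S x -> S != finset.set0.
Proof.
move=> [_ x1 xS]; apply/eqP => S0; move: x1; rewrite (face_sum xS) S0 big_set0.
by move/esym/eqP; rewrite oner_eq0.
Qed.

Let iterT_FpS (c : 'F_p) x : iter (c + 1)%R T x = T (iter c T x).
Proof. by rewrite val_FpS // -iterS; case: eqP => [->|//]; rewrite T_order. Qed.

Lemma equivariant_iter (S : {set V}) (f : E -> X) :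
  (forall a (x : E), face S x -> f (shiftm 1 (shiftm a x)) = T (f (shiftm a x))) ->
  forall (a : 'F_p) (x : E), face S x -> f (shiftm a x) = iter a T (f x).
Proof.
move=> fT a x fx; rewrite -{1}[a]natr_Zp; elim: (nat_of_ord a) => [|i IH].
  by rewrite shiftm0.
by rewrite -natr1 addrC -shiftmD fT //= IH.
Qed.

(** The shift permutes the compatible faces freely, so fillings are needed on one face per orbit
    only, the one with lead 0, and [T] transports them to the rest. Faces have at most [m + 1]
    vertices, hence boundary spheres of dimension below [m]. *)
Lemma equivariant_skeleton (x0 : X) d : (d <= m.+1)%N ->
  (forall e, (e < m)%N -> forall x : X, pi_trivial e x) ->
  exists f : E -> X, forall S : {set V}, compatible (mem S) -> (#|S| <= d)%N ->
    cont_on (face S) f /\ forall x, face S x -> f (shiftm 1 x) = T (f x).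
Proof.
move=> + piX; elim: d => [|d IH] dm.
  exists (fun=> x0) => S _; rewrite leqn0 cards_eq0 => S0.
  by split => [|x /face_neq0]; [exact: cont_on_cst|rewrite S0].
have [f fP] := IH (ltnW dm).
have fill (S : {set V}) : exists g : E -> X, compatible (mem S) -> #|S| = d.+1 ->
    cont_on (face S) g /\ forall x v, face S x -> v \in S -> x v.1 v.2 = 0 -> g x = f x.
  have [cS|nS] := pselect (compatible (mem S)); last by exists (fun=> x0) => /nS.
  have [SE|/eqP SE] := eqVneq #|S| d.+1; last by exists (fun=> x0) => _ /SE.
  have [||g cg gE] := @face_filling X d S f x0 SE.
  - by move=> e de; apply: piX; rewrite -ltnS -de.
  - move=> v vS; have [] // := fP (S :\ v).
      by apply: compatible_sub cS; exact: subD1set.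
    by move: SE; rewrite (cardsD1 v) vS add1n => -[->].
  - by exists g.
have {fill}[G GP] := choice fill.
(* For [c = lead S] the translated set has lead 0, so all faces of an orbit use the same filling. *)
pose F c S x := iter (c : 'F_p) T (G (shift_set (- c) S) (shiftm (- c) x)).
(* Selecting the formula by the support of [x] gives a single function on all faces; [f'S] checks
   that on each face it is the transported filling, boundary included. *)
pose f' x := if (#|supp_set x| <= d)%N then f x else F (lead (supp_set x)) (supp_set x) x.
have f'E x : (#|supp_set x| <= d)%N -> f' x = f x by rewrite /f' => ->.
have fiter (S : {set V}) x a : compatible (mem S) -> face S x -> (#|supp_set x| <= d)%N ->
    f (shiftm a x) = iter a T (f x).
  move=> cS fx sx; apply: (equivariant_iter (S := supp_set x)); last exact: face_supp fx.
  move=> b y fy.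
  have cb : compatible (mem (shift_set b (supp_set x))).
    by apply: compatible_shift; apply: compatible_sub cS; exact: supp_sub.
  have [_] := fP _ cb (leq_trans (eq_leq (card_shift_set _ _)) sx).
  by apply; exact: face_shift.
have f'S (S : {set V}) x : compatible (mem S) -> #|S| = d.+1 -> face S x ->
    f' x = F (lead S) S x.
  move=> cS SE fx; rewrite /f'; case: ifPn => [sx|]; last first.
    rewrite -ltnNge => sx; have -> // : supp_set x = S.
    by apply/eqP; rewrite eqEcard supp_sub //= SE.
  have [v vS xv] : exists2 v, v \in S & x v.1 v.2 = 0.
    have : ~~ (S \subset supp_set x).
      by apply/negP => /subset_leq_card; rewrite SE leqNgt ltnS sx.
    case/fintype.subsetPn => v vS; rewrite inE negbK => /eqP xv; by exists v.
  set c := lead S; rewrite /F.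
  have [_ /(_ (shiftm (- c) x) (shiftv (- c) v))->] := GP (shift_set (- c) S)
    (compatible_shift (a := - c) cS) (etrans (card_shift_set _ _) SE).
  - rewrite -(fiter (shift_set (- c) S)) ?shiftmD ?subrr ?shiftm0 //.
    + exact: compatible_shift.
    + exact: face_shift.
    + by rewrite supp_shift card_shift_set.
  - exact: face_shift.
  - by rewrite inE shiftvD opprK subrr shiftv0.
  - by rewrite mxE /= opprK subrK.
exists f' => S cS; rewrite leq_eqVlt => /orP[/eqP SE|]; last first.
  rewrite ltnS => Sd; have [c1 c2] := fP S cS Sd.
  have sS x : face S x -> (#|supp_set x| <= d)%N.
    by move=> /supp_sub/subset_leq_card/leq_trans; apply.
  split; first by apply: eq_cont_on c1 => x /sS/f'E.
  move=> x fx; rewrite !f'E ?c2 //; first exact: sS.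
  by rewrite supp_shift card_shift_set sS.
split.
  apply: (eq_cont_on (f := F (lead S) S)) => [x fx|]; first by rewrite (f'S S).
  rewrite /F; set c := lead S.
  have [cG _] := GP (shift_set (- c) S) (compatible_shift (a := - c) cS)
    (etrans (card_shift_set _ _) SE).
  apply: (cont_on_comp (B := setT) (g := iter c T)) => //.
    apply: cont_on_comp cG; last by move=> x fx; exact: face_shift.
    apply: cont_on_mx => i j.
    apply: (eq_cont_on (f := fun x : E => x i (j + c))) => [x _|];
      first by rewrite mxE opprK.
    exact: cont_on_coord.
  apply: continuous_cont_on; elim: (nat_of_ord c) => [x|i IHi x] /=; first exact: cvg_id.
  by apply: continuous_comp; [exact: IHi|exact: T_cont].
move=> x fx; have sS := supp_sub fx.
have [sd|] := leqP #|supp_set x| d.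
  rewrite !f'E //; last by rewrite supp_shift card_shift_set.
  by rewrite (fiter S) // val_Fp_nat // modn_small // prime_gt1.
move=> sd; have SE' : supp_set x = S by apply/eqP; rewrite eqEcard sS SE.
rewrite (f'S S x) // (f'S (shift_set 1 S) (shiftm 1 x)); last first.
- exact: face_shift.
- by rewrite card_shift_set.
- exact: compatible_shift.
have -> : lead (shift_set 1 S) = lead S + 1.
  apply: lead_shift => //; first exact: face_neq0 fx.
  by move=> v; rewrite inE shiftvD addNr shiftv0.
by rewrite /F iterT_FpS shift_setD shiftmD opprD subrK.
Qed.

End EquivariantMap.

(** Uniform continuity stated along the meshes [c / N], by near-covering compactness with [N] as the
    parameter; the radius is halved so that a moving centre stays in the ball. *)
Lemma near_unif_cont (R : realType) m n (K : set 'M[R]_(m, n)) (g : 'M[R]_(m, n) -> R) c e :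
  compact K -> cont_on K g -> 0 < e ->
  \forall N \near \oo, forall x y, K x -> K y -> `|x - y| <= c / N%:R -> `|g x - g y| < e.
Proof.
move=> cK cg e0.
have e2 : 0 < e / 2 by rewrite divr_gt0.
have := (compact_near_coveringP K).1 cK nat \oo
  (fun N x => K x -> forall y, K y -> `|x - y| <= c / N%:R -> `|g x - g y| < e) _.
move=> h; have {h} : \forall N \near \oo, K `<=` (fun x => K x ->
    forall y, K y -> `|x - y| <= c / N%:R -> `|g x - g y| < e).
  apply: h => x Kx.
  have /cvgrPdist_lt/(_ _ e2) := cg x Kx.
  rewrite /within /= => /nbhs_ballP[r /= r0 xr].
  have r2 : 0 < r / 2 by rewrite divr_gt0.
  have cN : \forall N \near \oo, c / N%:R < r / 2.
    near=> N; have N0 : 0 < N%:R :> R by rewrite ltr0n; near: N; exact: nbhs_infty_gt.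
    rewrite ltr_pdivrMr // mulrC -ltr_pdivrMr //; near: N; exact: nbhs_infty_gtr.
  exists (ball x (r / 2), [set N | c / N%:R < r / 2]); first by split => //;
    exact: nbhsx_ballx.
  move=> [x' N] /= [xx' Nr] Kx' y Ky xy.
  have bx' : ball x r x' by apply: le_ball xx'; rewrite ler_pdivrMr // ler_pMr // ler1n.
  have by' : ball x r y.
    rewrite [r]splitr; apply: ball_triangle xx' _.
    by rewrite -ball_normE /=; exact: le_lt_trans Nr.
  have h1 := xr _ bx' Kx'; have h2 := xr _ by' Ky.
  have -> : g x' - g y = (g x - g y) - (g x - g x') by ring.
  by rewrite (le_lt_trans (ler_normB _ _)) // [ltRHS]splitr ltrD.
by apply: filterS => N h x y Kx Ky; exact: h.
Unshelve. all: by end_near. Qed.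

(** * From equivariant weights to labels *)

Section AbstractTheorem.
Variables (p k : nat).
Hypothesis p_prime : prime p.

Notation E := 'M[RR]_(k.+1, (Zp_trunc (pdiv p)).+2).

Lemma compact_face (S : {set 'I_k.+1 * 'F_p}) : compact (@face RR p k S).
Proof.
(* Boundedness and closedness are checked on row vectors, and the face is the continuous image of
   the resulting compact set. *)
pose q := (Zp_trunc (pdiv p)).+2.
pose K := [set v : 'rV[RR]_(k.+1 * q) | face S (vec_mx v : E)].
have vE v i j : (vec_mx v : E) i j = v ord0 (mxvec_index i j) by rewrite mxE.
have cv A : cont_on A (vec_mx : 'rV[RR]_(k.+1 * q) -> E).
  apply: cont_on_mx => i j.
  apply: (eq_cont_on (f := fun v : 'rV[RR]_(k.+1 * q) => v ord0 (mxvec_index i j))) => [v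
    _|].
    by rewrite vE.
  exact: cont_on_coord.
have -> : @face RR p k S = [set (vec_mx v : E) | v in K].
  apply/seteqP; split => x /=; last by move=> [v Kv <-].
  by move=> fx; exists (mxvec x); rewrite /K /= mxvecK.
apply: continuous_compact; first by apply/cont_onP; exact: cv.
apply: bounded_closed_compact.
  exists 1; split; first exact: num_real.
  move=> c c1 v [v0 v1 _]; apply: (le_trans _ (ltW c1)); apply: mx_norm_le => // i b.
  rewrite (ord1 i); case/mxvec_indexP: b => a b; rewrite -vE ger0_norm // -v1.
  rewrite (bigD1 a) //= (bigD1 b) //= -addrA lerDl addr_ge0 // sumr_ge0 // => i' _.
  by rewrite sumr_ge0.
have cvi i j : continuous (fun v : 'rV[RR]_(k.+1 * q) => (vec_mx v : E) i j).
  apply: cont_onT; apply: (cont_on_comp (cv setT) (B := setT) (g :=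
    fun x : E => x i j)) => //.
  exact: cont_on_coord.
have -> : K = [set v | forall i j, 0 <= (vec_mx v : E) i j] `&`
  ([set v | \sum_i \sum_j (vec_mx v : E) i j = 1] `&`
   [set v | forall i j, (i, j) \notin S -> (vec_mx v : E) i j = 0]).
  apply/seteqP; split => v /=.
    move=> [v0 v1 vS]; split => //; split => // i j ij.
    by apply/eqP; apply: contraNT ij; exact: vS.
  move=> [v0 [v1 vS]]; split => // i j; apply: contraNT => ij; apply/eqP; exact: vS.
apply: closedI.
  apply: closed_all => i; apply: closed_all => j.
  by apply: closed_le; [exact: cst_continuous|exact: cvi].
apply: closedI.
  apply: closed_eqr; last exact: cst_continuous.
  apply: cont_onT; apply: cont_on_sum => i; apply: cont_on_sum => j.
  by apply: continuous_cont_on; exact: cvi.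
apply: closed_all => i; apply: closed_all => j.
apply: (@closed_impl _ _ [set v | (vec_mx v : E) i j = 0]).
by apply: closed_eqr; [exact: cvi|exact: cst_continuous].
Qed.

Variables (X : topologicalType) (T : X -> X).
Hypothesis T_cont : continuous T.
Hypothesis T_order : forall x, iter p T x = x.

Lemma no_equivariant_weights (w : 'I_k -> 'F_p -> X -> RR) (x0 : X) :
  (forall e, (e < k)%N -> forall x : X, pi_trivial e x) ->
  (forall i j, continuous (w i j)) ->
  (forall x, \sum_i \sum_j w i j x = 1) ->
  (forall x i j j', 0 < w i j x -> 0 < w i j' x -> j = j') ->
  (forall x i j, w i (j + 1) (T x) = w i j x) ->
  False.
Proof.
move=> piX cw w1 wexc wT.
have [f fP] := equivariant_skeleton p_prime T_cont T_order x0 (leqnn k.+1) piX.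
have {}fP (S : {set 'I_k.+1 * 'F_p}) : compatible (mem S) ->
    cont_on (face S) f /\ forall x, face S x -> f (shiftm 1 x) = T (f x).
  move=> cS; apply: fP => //.
  have fst_inj : {in S &, injective fst} by move=> x y xS yS; exact: cS.
  by rewrite -(card_in_imset fst_inj) (leq_trans (max_card _)) // card_ord.
(* One more than the number of weights in the denominator: weights with sum 1 cannot all be at most
   [eps]. *)
pose eps : RR := ((k * (Zp_trunc (pdiv p)).+2).+1%:R)^-1.
have eps0 : 0 < eps by rewrite invr_gt0 ltr0n.
have wbig x : exists i j, eps < w i j x.
  apply: contrapT => nex.
  have le i j : w i j x <= eps by rewrite leNgt; apply/negP => h; apply: nex; exists i, j.
  have : \sum_i \sum_j w i j x <= \sum_(i < k) \sum_(j < (Zp_trunc (pdiv p)).+2) eps.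
    by apply: ler_sum => i _; apply: ler_sum => j _.
  rewrite w1 !sumr_const !card_ord -mulrnA -mulr_natr ler_pdivlMl ?ltr0n //.
  by rewrite mulr1 ler_nat mulnC ltnn.
have [i0 _] := wbig x0.
(* The colour is picked by a condition quantified over all Z/p-components, hence unchanged by [T].
   The component is then the only one of positive weight in that colour, so it follows the shift.
   The defaults are never reached. *)
pose ci x := odflt i0 [pick i | [exists j, eps < w i j x]].
pose cj x := odflt 0 [pick j | eps < w (ci x) j x].
have cP x : eps < w (ci x) (cj x) x.
  have : [exists j, eps < w (ci x) j x].
    rewrite /ci; case: pickP => //= h; have [i [j ij]] := wbig x.
    by have := h i; rewrite /= => /existsP []; exists j.
  by rewrite /cj; case: pickP => //= h /existsP[j]; rewrite h.
have ciT x : ci (T x) = ci x.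
  congr odflt; apply: eq_pick => i; apply/existsP/existsP => -[j jP].
    by exists (j - 1); rewrite -wT subrK.
  by exists (j + 1); rewrite wT.
have cjT x : cj (T x) = cj x + 1.
  apply: (wexc (T x) (ci (T x))); first exact: lt_trans (cP _).
  by rewrite ciT wT; exact: lt_trans (cP _).
pose l y := (ci (f y), cj (f y)).
have near_N : \forall N \near \oo, forall (S : {set 'I_k.+1 * 'F_p}) i j,
   compatible (mem S) -> forall x y, face S x -> face S y ->
   `|x - y| <= k.*2%:R / N%:R -> `|w i j (f x) - w i j (f y)| < eps.
  apply: filter_forall => S; apply: filter_forall => i; apply: filter_forall => j.
  have [cS|ncS] := pselect (compatible (mem S)); last by apply: nearW => N /ncS.
  have [cf _] := fP S cS.
  have := near_unif_cont k.*2%:R (compact_face (S := S))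
    (cont_on_comp cf (B := setT) (fun _ _ => I) (continuous_cont_on (cw i j))) eps0.
  by apply: filterS => N hN _; exact: hN.
have [N [NP N0]] := filter_ex (filterI near_N (nbhs_infty_gt 0)).
apply: (@Zp_tucker RR p k N p_prime N0 l).
  move=> S x cS fx; have [_ fT] := fP S cS.
  by rewrite /l fT // ciT cjT.
move=> S x y cS fx fy xy; rewrite /l /= => e; rewrite e; congr pair.
apply: (wexc (f y) (ci (f y))); last exact: lt_trans (cP _).
(* A weight above [eps] at [f x] varies by less than [eps], so it is still positive at [f y], where
   exclusivity identifies the components. *)
have := NP S (ci (f x)) (cj (f x)) cS x y fx fy xy.
rewrite ltr_norml => /andP[_]; have := cP (f x); rewrite e; lra.
Qed.

End AbstractTheorem.

(** * The realization of an order complex *)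

Section Masses.
Variables (d : Order.disp_t) (P : porderType d).

Definition mass (chi : P -> bool) (a : realization P) : RR :=
  \sum_(x \in supp (rpt a)) rpt a x *+ chi x.

Lemma supp_finite (a : realization P) : finite_set (supp (rpt a)).
Proof. by case: (rptP a). Qed.

Lemma mass_widen chi (a : realization P) (c : set P) : finite_set c ->
  supp (rpt a) `<=` c ->
  mass chi a = \sum_(x <- finmap.enum_fset (fset_set c)) rpt a x *+ chi x.
Proof.
move=> fc ac; rewrite /mass -fsbig_finite //; apply: fsbig_widen => // x [_ nax] /=.
have -> : rpt a x = 0 by apply/eqP; apply: contra_notT nax.
by rewrite mul0rn.
Qed.

Lemma continuous_real_openP (U : topologicalType) (f : realization P -> U) :
  (forall O, open O -> real_open (f @^-1` O)) -> continuous f.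
Proof.
by move=> h; apply/continuousP => O /h.
Qed.

Lemma mass_continuous chi : continuous (mass chi).
Proof.
apply: continuous_real_openP => O oO c fc cc.
pose g (h : {ptws P -> RR}) := \sum_(x <- finmap.enum_fset (fset_set c)) h x *+ chi x.
exists (g @^-1` O); split.
  apply: open_comp => // h _; apply: cont_onT; apply: cont_on_sum => x.
  case: (chi x); last exact: cont_on_cst.
  apply: continuous_cont_on; exact: (@proj_continuous P (fun=> RR) x).
by move=> b bc; rewrite /preimage /= (mass_widen chi fc bc).
Qed.

Lemma mass_gt0 chi a : 0 < mass chi a -> exists2 x, supp (rpt a) x & chi x.
Proof.
move=> m0; apply: contrapT => nex; move: m0.
rewrite /mass fsbig1 ?ltxx // => x xa; case E: (chi x) => //.
by case: nex; exists x.
Qed.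

Lemma mass_total (k : nat) (J : finType) (kappa : P -> 'I_k) (j : P -> J) a :
  \sum_i \sum_b mass (fun x => (kappa x == i) && (j x == b)) a = 1.
Proof.
have fa := supp_finite a; have [_ _ _ <-] := rptP a.
rewrite [RHS]fsbig_finite //.
transitivity (\sum_i \sum_(x <- finmap.enum_fset (fset_set (supp (rpt a)))) \sum_b
    rpt a x *+ ((kappa x == i) && (j x == b))).
  apply: eq_bigr => i _; rewrite exchange_big /=; apply: eq_bigr => b _.
  exact: mass_widen.
rewrite exchange_big /=; apply: eq_bigr => x _.
rewrite (bigD1 (kappa x)) //= (bigD1 (j x)) //= !eqxx mulr1n.
rewrite !big1 ?addr0 // => [i ik|b bj]; last by rewrite eq_sym (negbTE bj).
by rewrite big1 // => b _; rewrite eq_sym (negbTE ik).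
Qed.

End Masses.

(** * The group action on the realization *)

Section Translation.
Variables (gT : finGroupType) (d : Order.disp_t) (P : porderType d).
Variables (act : gT -> P -> P).
Hypothesis actP : is_Gposet act.

Lemma actK g : cancel (act g) (act g^-1%g).
Proof. by case: actP => a1 aM _ x; rewrite -aM mulVg a1. Qed.

Lemma actKV g : cancel (act g^-1%g) (act g).
Proof. by case: actP => a1 aM _ x; rewrite -aM mulgV a1. Qed.

Lemma act_inj g : injective (act g).
Proof. exact: can_inj (actK g). Qed.

Lemma comparable_act g x y : comparable_in x y -> comparable_in (act g x) (act g y).
Proof. by case: actP => _ _ mono [xy|yx]; [left|right]; exact: mono. Qed.

Lemma supp_translate g (a : P -> RR) :
  supp (fun y => a (act g^-1%g y)) = act g @` supp a.
Proof.
apply/seteqP; split => x /=; rewrite /supp /=.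
  by move=> ax; exists (act g^-1%g x) => //; rewrite actKV.
by move=> [y ay <-]; rewrite actK.
Qed.

Lemma simplex_pt_translate g (a : realization P) :
  simplex_pt (fun y => rpt a (act g^-1%g y)).
Proof.
have [a0 fa ca a1] := rptP a; split.
- by move=> x; exact: a0.
- by rewrite supp_translate; exact: finite_image.
- rewrite supp_translate => _ _ [x ax <-] [y ay <-].
  by apply: comparable_act; exact: ca.
- rewrite supp_translate fsbig_image; last by move=> x y _ _; exact: act_inj.
  by rewrite -a1; apply: eq_fsbigr => x _; rewrite actK.
Qed.

Definition translate g (a : realization P) : realization P :=
  Defs.Real (simplex_pt_translate g a).

Lemma translateP g a : is_translate act g a (translate g a).
Proof. by []. Qed.

Lemma realization_eq (a b : realization P) : rpt a = rpt b -> a = b.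
Proof.
case: a b => a aP [b bP] /= e; subst b; congr Defs.Real; exact: Prop_irrelevance.
Qed.

Lemma is_translateE g a b : is_translate act g a b -> b = translate g a.
Proof. by move=> h; apply: realization_eq; apply: funext => y; exact: h. Qed.

Lemma translate_continuous g : continuous (translate g).
Proof.
apply: continuous_real_openP => U oU c fc cc.
have fc' : finite_set (act g @` c) by exact: finite_image.
have cc' : chain_set (act g @` c).
  by move=> _ _ [x cx <-] [y cy <-]; apply: comparable_act; exact: cc.
have [W [oW WP]] := (oU : real_open U) _ fc' cc'.
(* The trace of the preimage on [c] is pulled back from the trace of [U] on the translated chain;
   [pre] is continuous because each of its coordinates is a projection. *)
pose pre (h : {ptws P -> RR}) : {ptws P -> RR} := fun y => h (act g^-1%g y).
exists (pre @^-1` W); split.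
  apply: open_comp => // h _; apply/cvg_sup => y; apply/cvg_image.
    by apply/seteqP; split => // z _; exists (fun=> z).
  move=> O Oy; exists ((fun z : P -> RR => z y) @^-1` O).
    exact: (@proj_continuous P (fun=> RR) (act g^-1%g y) h O Oy).
  by apply/seteqP; split => [_ [z zO <-] //|z zO]; exists (fun=> z).
move=> b bc; apply: (WP (translate g b)).
rewrite /= supp_translate => _ [x bx <-]; exists x => //; exact: bc.
Qed.

Lemma iter_translate g i a : iter i (translate g) a = translate (g ^+ i) a.
Proof.
elim: i => [|i IH]; apply: realization_eq; apply: funext => y /=.
  by rewrite expg0 invg1; case: actP => ->.
rewrite IH /=; congr (rpt a).
by case: actP => _ aM _; rewrite -aM -invMg -expgS.
Qed.

Lemma translate1 a : translate 1%g a = a.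
Proof.
by apply: realization_eq; apply: funext => y /=; rewrite invg1; case: actP => ->.
Qed.

Lemma mass_translate g (chi chi' : P -> bool) a :
  (forall x, chi' (act g x) = chi x) -> mass chi' (translate g a) = mass chi a.
Proof.
move=> h; rewrite /mass /= supp_translate fsbig_image; last by move=> x y _ _;
  exact: act_inj.
by apply: eq_fsbigr => x _; rewrite actK h.
Qed.

End Translation.

(** * Labels from a colouring *)

Section CyclicLabels.
Variables (gT : finGroupType) (p : nat) (s : gT).
Hypotheses (p_prime : prime p) (s_order : #[s]%g = p).

Let sg (j : 'F_p) : gT := (s ^+ j)%g.

Let sgD i j : sg (i + j) = (sg i * sg j)%g.
Proof.
rewrite /sg -expgD -[RHS]expg_mod_order s_order.
by rewrite -[i in LHS]natr_Zp -[j in LHS]natr_Zp -natrD val_Fp_nat.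
Qed.

Let sg_inj : injective sg.
Proof.
move=> i j /eqP; rewrite /sg eq_expg_mod_order s_order !modn_small ?ltn_Fp // => /eqP.
exact: val_inj.
Qed.

Let sg0 : sg 0 = 1%g. Proof. by rewrite /sg expg0. Qed.

Let sg1 : sg 1 = s.
Proof. by rewrite /sg (val_Fp_nat p_prime 1) modn_small ?expg1 // prime_gt1. Qed.

Variables (d : Order.disp_t) (Q : porderType d) (act : gT -> Q -> Q).
Hypotheses (actP : is_Gposet act) (act_free : is_free act).

(** An inequality between [x] and its translate propagates along the powers of [g], which return to
    the identity, so the chain closes up. *)
Lemma comparable_fixed g x : comparable_in x (act g x) -> act g x = x.
Proof.
have [a1 aM mono] := actP.
have up h y : (y <= act h y)%O -> act h y = y.
  move=> le; have it i : (act h y <= act (h ^+ i.+1)%g y)%O.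
    elim: i => [|i IH]; first by rewrite expg1.
    rewrite expgS aM; apply: (le_trans (mono h _ _ le)); exact: mono.
  apply/eqP; rewrite eq_le le andbT; have := it #[h]%g.-1.
  by rewrite prednK ?order_gt0 // expg_order a1.
case=> [/up //|le]; have := mono g^-1%g _ _ le.
by rewrite (actK actP) => /up e; rewrite -{1}e (actKV actP).
Qed.

Lemma act_eq g h x : act g x = act h x -> g = h.
Proof.
move=> e; apply/eqP; rewrite -(can_eq (mulKg h^-1%g)) mulVg; apply/eqP.
by apply: (act_free (x := x)); case: (actP) => _ aM _; rewrite aM e (actK actP).
Qed.

Lemma cyclic_labels (k : nat) (c : Q -> 'I_k) :
  (forall x y, strong_compat_adj act x y -> c x <> c y) ->
  exists (kappa : Q -> 'I_k) (j : Q -> 'F_p),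
    [/\ forall x, kappa (act s x) = kappa x, forall x, j (act s x) = j x + 1
      & forall x y, comparable_in x y -> kappa x = kappa y -> j x = j y].
Proof.
move=> col; have [a1 aM mono] := actP.
(* The representative is chosen from a predicate depending only on the orbit of [x] under the powers
   of [s], which makes [rep] invariant under [s]. *)
pose orb x : pred Q := fun y => `[< exists j, act (sg j) y = x >].
have orbx x : exists y, orb x y by exists x; apply/asboolP; exists 0; rewrite sg0.
pose rep x := xchoose (orbx x).
have repP x : exists j, act (sg j) (rep x) = x by have /asboolP := xchooseP (orbx x).
have [j jP] := choice repP.
have repS x : rep (act s x) = rep x.
  apply: eq_xchoose => y; apply/asboolP/asboolP => -[i].
    move=> e; exists (i - 1); apply: (act_inj actP (g := s)).
    by rewrite -e -aM -[X in (X * _)%g]sg1 -sgD addrC subrK.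
  by move=> <-; exists (1 + i); rewrite sgD sg1 aM.
exists (c \o rep), j; split => [x|x|x y xy /= cxy].
- by rewrite /= repS.
- apply: sg_inj; apply: (act_eq (x := rep x)).
  by rewrite -{1}(repS x) jP addrC sgD aM jP sg1.
apply: contrapT => jxy.
have {}xy : comparable_in (rep x) (act (sg (j y - j x)) (rep y)).
  have jxy' : sg (j y) = (sg (j x) * sg (j y - j x))%g by rewrite -sgD addrC subrK.
  have e : comparable_in (act (sg (j x)) (rep x)) (act (sg (j y)) (rep y)) by rewrite !jP.
  have := comparable_act actP (sg (j x))^-1%g e.
  by rewrite (actK actP) -aM jxy' mulKg.
have g1 : sg (j y - j x) != 1%g.
  by rewrite -sg0 (inj_eq sg_inj) subr_eq0; apply/eqP => e; apply: jxy.
(* Distinct positions give a nontrivial group element, hence adjacent representatives, unless these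
   share an orbit of the whole group. In one orbit comparable elements are equal, so [x = y],
   against [jxy]. *)
have [orbxy|norb] := pselect (orbit_of act (rep x) (rep y)); last first.
  by apply: (col (rep x) (rep y)) => //; split => //; exists (sg (j y - j x)).
case: orbxy => h _ e; move: xy; rewrite -e -aM => /comparable_fixed exy.
apply: jxy; suff -> : x = y by [].
rewrite -(jP x) -exy aM e -aM -[in RHS](jP y); congr act.
by rewrite -sgD addrC subrK.
Qed.

End CyclicLabels.

Section LabelWeights.
Variables (gT : finGroupType) (p k : nat) (s : gT).
Variables (d : Order.disp_t) (Q : porderType d) (act : gT -> Q -> Q).
Hypothesis actP : is_Gposet act.
Variables (kappa : Q -> 'I_k) (j : Q -> 'F_p).
Hypotheses (kappaS : forall x, kappa (act s x) = kappa x)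
  (jS : forall x, j (act s x) = j x + 1)
  (kj : forall x y, comparable_in x y -> kappa x = kappa y -> j x = j y).

Definition label_weight (i : 'I_k) (b : 'F_p) : realization Q -> RR :=
  mass (fun x => (kappa x == i) && (j x == b)).

Lemma label_weight_exclusive a i b b' :
  0 < label_weight i b a -> 0 < label_weight i b' a -> b = b'.
Proof.
move=> /mass_gt0[x xa /andP[/eqP xi /eqP <-]] /mass_gt0[y ya /andP[/eqP yi /eqP <-]].
by apply: kj; [case: (rptP a) => _ _ ca _; exact: ca|rewrite xi yi].
Qed.

Lemma label_weight_translate a i b :
  label_weight i (b + 1) (translate actP s a) = label_weight i b a.
Proof.
apply: mass_translate => x; rewrite kappaS jS; congr (_ && _).
by rewrite (inj_eq (addIr 1)).
Qed.

End LabelWeights.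

Theorem theorem9 (gT : finGroupType) (n : int)
  (dP : Order.disp_t) (P : porderType dP) (actP : gT -> P -> P)
  (dQ : Order.disp_t) (Q : porderType dQ) (actQ : gT -> Q -> Q) :
  (1 < #|gT|)%N ->
  is_Gposet actP ->
  n_connected (realization P) n ->
  is_Gposet actQ -> is_free actQ ->
  chromatic_le (strong_compat_adj actQ) (n + 1) ->
  (~ exists F : realization P -> realization Q,
       continuous F /\ real_equivariant actP actQ F) /\
  (forall lam : P -> Q, (forall g x, lam (actP g x) = actQ g (lam x)) ->
     exists x y : P, comparable_in x y /\ ~ comparable_in (lam x) (lam y)).
Proof.
move=> G1 GP [exP piP] GQ freeQ [k [kn [c cP]]].
have pG : prime (pdiv #|gT|) by exact: pdiv_prime.
have dG : (pdiv #|gT| %| #|[set: gT]%G|)%N by rewrite cardsT pdiv_dvd.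
have [s _ sp] := Cauchy pG dG.
set p := pdiv #|gT| in pG sp.
have [kappa [j [kappaS jS kj]]] := cyclic_labels pG sp GQ freeQ cP.
(* From [0 <= k <= n + 1] one gets [-1 <= n], so the realization is nonempty even when [k = 0]. *)
have [x0 _] : exists x : realization P, True by apply: exP; lia.
have pi_lt e : (e < k)%N -> forall x : realization P, pi_trivial e x.
  by move=> ek; apply: piP; lia.
have T_order a : iter p (translate GP s) a = a.
  by rewrite iter_translate -sp expg_order translate1.
have main := no_equivariant_weights pG (@translate_continuous _ _ _ _ GP s) T_order x0
  pi_lt.
split.
  move=> [F [cF eF]].
  apply: (main (fun i b a => label_weight kappa j i b (F a))).
  - move=> i b a; apply: continuous_comp; first exact: cF.
    exact: mass_continuous.
  - by move=> a; exact: mass_total.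
  - by move=> a i b b'; exact: label_weight_exclusive kj _ _ _ _.
  - move=> a i b; rewrite (is_translateE GQ (eF s a _ (translateP GP s a))).
    exact: label_weight_translate.
move=> lam lamE; apply: contrapT => nex.
have lam_comp x y : comparable_in x y -> comparable_in (lam x) (lam y).
  by move=> xy; apply: contrapT => nxy; apply: nex; exists x, y.
(* The label conditions mention comparability only, so they pull back along [lam] although it need
   not preserve the order. *)
apply: (main (label_weight (kappa \o lam) (j \o lam))).
- by move=> i b; exact: mass_continuous.
- by move=> a; exact: mass_total.
- by move=> a i b b'; apply: label_weight_exclusive => x y /lam_comp; exact: kj.
- move=> a i b; apply: label_weight_translate => x /=; first by rewrite lamE kappaS.
  by rewrite lamE jS.
Qed.
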